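(* Let $\lambda,\mu>0$ and let $d\ge 2$ be an integer. For each $n$, consider the network on the complete graph with $n$ vertices, with call arrival rate $\lambda$ per edge and mean call duration $1/\mu$, in which every edge has capacity $2B$ with $B=B_n$ (half of it, $B_n$, reserved for direct calls and the other half, $B_n$, reserved for alternative routes). All probabilities below are under the stationary regime of the network. (i) Under the $d$-DAR policy, edge capacity $$B=\Omega\left(\sqrt{\frac{\ln n}{d\ln\ln n}}\right)\qquad\text{as } n\to\infty$$ is necessary to ensure that a new call is not lost with high probability. That is, if $(B_n)$ is such that under $d$-DAR a newly arriving call is not lost with high probability, then there is a constant $C>0$ such that $B_n\ge C\sqrt{\ln n/(d\ln\ln n)}$ for all $n$ large enough. (ii) Under the BDAR* policy with parameter $d$ (which ignores the $B$ direct connections of each edge and uses only the $B$ alternative connections), edge capacity $$B=\frac{\ln\ln n}{\ln d}+o\left(\frac{\ln\ln n}{\ln d}\right)\qquad\text{as } n\to\infty$$ suffices to ensure that a new call is not lost with high probability. That is, there is a sequence $(B_n)$ of this form such that, under BDAR*, a newly arriving call is not lost with high probability.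
   Context: Network model. The network is the complete graph $G=(V,E)$ with $|V|=n$ vertices (stations) and $N=\binom n2$ edges (links). For each pair of vertices, call requests between them arrive according to a Poisson process of rate $\lambda$; these processes are independent over the pairs. Call durations are exponentially distributed with mean $1/\mu$, independent of each other and of all arrival times. Requests are processed on-line: on arrival a call is either assigned a path, which it keeps for its whole duration, or it is rejected (lost). Each edge has capacity $2B$ calls: $B$ of these are used only for calls between the two endpoints of that edge routed directly on it, and the other $B$ are used only for calls for which the edge is part of an alternative (length-two) route. The parameter $B=B_n$ may depend on $n$ and is nondecreasing in $n$. An alternative route for a call between $u$ and $v$ is a path $u-w-v$ with $w\ne u,v$; it occupies one alternative-route connection on each of its two edges, and it is available if both edges have a free alternative-route connection. $d$-DAR ($d$-Dynamic Alternative Routing): a new call is routed on its direct edge if direct capacity is available there. If not, alternative routes of length two are chosen at random (uniformly and independently) one after another, up to $d$ choices, and the call is assigned to the first available one. If none of the $d$ choices is available, the call is rejected. BDAR* with parameter $d$: direct links are ignored. For each new call, $d$ length-two alternative routes are chosen at random (uniformly and independently). The load of a route is the maximum of the loads of its two edges, where the load of an edge is the number of active calls using it as part of an alternative route. The call is assigned to the chosen route with minimum load (ties broken by an arbitrary fixed rule). If none of the $d$ chosen routes is available (each edge has $B$ connections for alternative routes), the call is rejected. For fixed $n$, each policy induces a continuous-time stochastic process converging to a stationary regime; the probability that a new call is lost is the probability that a newly arriving call is rejected under the stationary distribution. ''With high probability'' means with probability at least $1-1/n^c$ for some constant $c>0$ and all $n$ large enough. *)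

(* Defs.v *)
From HB Require Import structures.
From mathcomp Require Import all_boot all_order all_algebra.
From mathcomp Require Import all_classical all_reals all_analysis.

Set Implicit Arguments.
Unset Strict Implicit.
Unset Printing Implicit Defensive.

Import Order.TTheory GRing.Theory Num.Theory.
Import numFieldNormedType.Exports.

Local Open Scope ring_scope.

Definition edge (n : nat) : finType := {e : {set 'I_n} | #|e| == 2%N}.

(* The route (e, w) with e = {u, v} is the path u - w - v, where w <> u, v. *)
Definition route (n : nat) : finType :=
  {r : edge n * 'I_n | r.2 \notin val r.1}.

Definition ends n (r : route n) : edge n := (val r).1.
Definition mid n (r : route n) : 'I_n := (val r).2.

Definition legs n (r : route n) : {set edge n} :=
  [set f : edge n | [exists u in val (ends r), val f == [set u; mid r]]].

(* [inl e] is the one-edge path of a call carried directly on e, [inr r] the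
   two-edge path of a call carried on the alternative route r. *)
Definition call_path (n : nat) : finType := (edge n + route n)%type.

(* The state of the network is the number of active calls on each path.  As
   durations are exponential, this is a Markovian description.  No path can
   carry more than B calls; the capacity of the edges for alternative calls is
   the predicate [feasible]. *)
Definition state (n B : nat) : finType := {ffun call_path n -> 'I_B.+1}.

Definition alt_load n B (s : state n B) (f : edge n) : nat :=
  \sum_(r : route n | f \in legs r) s (inr r).

Definition feasible n B (s : state n B) : bool :=
  [forall f : edge n, (alt_load s f <= B)%N].

Definition available n B (s : state n B) (r : route n) : bool :=
  [forall f in legs r, (alt_load s f < B)%N].

Definition route_load n B (s : state n B) (r : route n) : nat :=
  \max_(f in legs r) alt_load s f.

(* On a path carrying B calls, [add_call] would wrap around to 0; the policies
   below never assign a call to such a path. *)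
Definition add_call n B (p : call_path n) (s : state n B) : state n B :=
  [ffun q => if q == p then inord (s q).+1 else s q].

Definition del_call n B (p : call_path n) (s : state n B) : state n B :=
  [ffun q => if q == p then inord (s q).-1 else s q].

(* The d random alternatives of a call between the ends of e are independent
   and uniform, i.e. uniform over this set (repetitions are allowed). *)
Definition choices n (d : nat) (e : edge n) : {set d.-tuple (route n)} :=
  [set c : d.-tuple (route n) | all (fun r => ends r == e) c].

(* [P s e c] is the path given to a call between the ends of e that arrives in
   state s and draws the alternatives c; [None] means that it is rejected. *)
Definition policy (n B d : nat) : Type :=
  state n B -> edge n -> d.-tuple (route n) -> option (call_path n).

Definition dar (n B d : nat) : policy n B d := fun s e c =>
  if (s (inl e) < B)%N then Some (inl e)
  else omap inr (ohead [seq r <- c | available s r]).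

(* A selection of one of the d alternatives; [min_load_rule] says that it is one
   of minimum load, so that only the way ties are broken is left open. *)
Definition selection (n B d : nat) : Type :=
  state n B -> edge n -> d.-tuple (route n) -> 'I_d.

Definition min_load_rule n B d (pick : selection n B d) : Prop :=
  forall s e (c : d.-tuple (route n)) (j : 'I_d),
    (route_load s (tnth c (pick s e c)) <= route_load s (tnth c j))%N.

Definition bdar n B d (pick : selection n B d) : policy n B d := fun s e c =>
  let r := tnth c (pick s e c) in
  if available s r then Some (inr r) else None.

(* Transition rates of the network: calls arrive at rate lam for each pair of
   vertices, and each active call ends at rate mu.  The value on the diagonal
   is irrelevant, since it cancels in the balance equations. *)
Definition rate (R : realType) (lam mu : R) n B d (P : policy n B d)
    (s t : state n B) : R :=
  \sum_(e : edge n) \sum_(c in choices d e | omap (fun p => add_call p s) (P s e c) == Some t)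
     lam / #|choices d e|%:R
  + \sum_(p : call_path n | del_call p s == t) mu *+ s p.

Definition law (R : realType) (n B : nat) : Type := {ffun state n B -> R}.

Definition stationary (R : realType) (lam mu : R) n B d (P : policy n B d)
    (pi : law R n B) : Prop :=
  [/\ forall s, 0 <= pi s,
      \sum_s pi s = 1,
      forall s, ~~ feasible s -> pi s = 0 &
      forall t, \sum_s pi s * rate lam mu P s t
                = pi t * \sum_s rate lam mu P t s].

(* Probability that a new call is rejected when the network has law pi: all pairs
   have the same arrival rate, so the new call is for a uniform random pair. *)
Definition loss_prob (R : realType) n B d (P : policy n B d) (pi : law R n B) : R :=
  \sum_s pi s *
    ((\sum_(e : edge n)
        #|[set c in choices d e | P s e c == None]|%:R / #|choices d e|%:R)
     / #|edge n|%:R).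

Local Open Scope classical_set_scope.

Definition whp (R : realType) (p : nat -> R) : Prop :=
  exists2 c : R, 0 < c & \forall n \near \oo, 1 - 1 / n%:R `^ c <= p n.

(* [unique] states that pi n is the stationary law, and the only one. *)
Definition not_lost_whp (R : realType) (lam mu : R) d (B : nat -> nat)
    (P : forall n, policy n (B n) d) : Prop :=
  exists pi : forall n, law R n (B n),
    (forall n, unique (stationary lam mu (P n)) (pi n)) /\
    whp (fun n => 1 - loss_prob (P n) (pi n)).

(* Main.v *)
(** Both parts test the stationary law pi against functions phi of the state
    through E_pi[L phi] = 0, L being the generator.

    (i) Under DAR the direct loads of two edges form an autonomous Markov chain
    with a unique stationary law, so they are independent and each direct link is
    full with the same probability p.  By Chebyshev's inequality a fraction at
    least about p of the calls that may use an edge f as a leg find their direct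
    link full, whatever the alternative load of f.  Taking phi = 1{load f > j}
    gives mu (j+1) x_(j+1) >= lam (p x_j - eps), where x_j is the probability that
    a random edge has alternative load j and eps is an error controlled by
    loss^(1/d).  As p x_B <= eps and the x_j sum to 1, eps is at least
    about B^(-O(B^2)).

    (ii) Under BDAR*, suppose that every vertex has at most b incident edges of
    load at least k.  A call can raise the load of an edge from at least k only if
    its d choices all have load at least k, so the sum W over the edges at a vertex
    of the excess (load - k)^+ grows at rate O(n (b/n)^d), whereas it decreases at
    rate at least mu W / 2.  Taking phi = 1{W > m} yields a geometric tail for W,
    hence a bound of order n (b/n)^d on the number of edges of load at least k+1 at
    each vertex.  From a constant level on, these numbers decrease doubly
    exponentially, down to sqrt n after about ln ln n / ln d levels. *)

Require Import Defs.
From HB Require Import structures.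
From mathcomp Require Import all_boot all_order all_algebra.
From mathcomp Require Import all_classical all_reals all_analysis.
From mathcomp Require Import ring lra zify.
Import Order.TTheory GRing.Theory Num.Theory.
Import numFieldNormedType.Exports.
Local Open Scope ring_scope.
Set Implicit Arguments.
Unset Strict Implicit.
Unset Printing Implicit Defensive.

(** * Stationary laws of finite chains *)

Section FiniteChain.
Variables (R : realFieldType) (S : finType) (r : S -> S -> R).
Hypothesis r_ge0 : forall s t, 0 <= r s t.

Definition balanced (w : S -> R) :=
  forall t, \sum_s w s * r s t = w t * \sum_s r t s.

Definition subbalanced (w : S -> R) :=
  forall t, w t * \sum_s r t s <= \sum_s w s * r s t.

(** The defects, inflow minus outflow, are nonnegative. Summed over all states they cancel, since
    each transition is counted once as inflow and once as outflow, so each of them is zero. *)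
Lemma subbalanced_balanced w : subbalanced w -> balanced w.
Proof.
move=> sw t; apply/eqP; rewrite -subr_eq0; apply/eqP.
have ge0 i : true -> 0 <= \sum_s w s * r s i - w i * \sum_s r i s.
  by move=> _; rewrite subr_ge0.
suff /eqP : \sum_i (\sum_s w s * r s i - w i * \sum_s r i s) == 0.
  by move/psumr_eq0P => /(_ ge0) ->.
rewrite sumrB exchange_big /= subr_eq0; apply/eqP.
by apply: eq_bigr => i _; rewrite mulr_sumr.
Qed.

Lemma balanced_norm w : balanced w -> balanced (fun s => `|w s|).
Proof.
move=> bw; apply: subbalanced_balanced => t.
have r0 : 0 <= \sum_s r t s by apply: sumr_ge0.
rewrite -[X in _ * X]ger0_norm // -normrM -bw.
apply: le_trans (ler_norm_sum _ _ _) _.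
by apply: ler_sum => s _; rewrite normrM (ger0_norm (r_ge0 _ _)).
Qed.

(* The matrix of the chain kills constants, so it has a nonzero row vector v in its
   kernel, and the entrywise absolute value of v is again balanced. *)
Lemma balanced_exists (z : S) :
  exists w : S -> R, [/\ forall s, 0 <= w s, \sum_s w s = 1 & balanced w].
Proof.
pose m := #|S|.
pose Q : 'M[R]_m := \matrix_(i, j) (r (enum_val i) (enum_val j)
   - (i == j)%:R * \sum_s r (enum_val i) s).
have sumE (F : S -> R) : \sum_s F s = \sum_(i < m) F (enum_val i).
  rewrite (reindex (@enum_val S predT)) //=.
  by exists enum_rank => x _; rewrite ?enum_valK ?enum_rankK.
have /det0P[v v0 vQ] : \det Q == 0.
  rewrite -det_tr; apply/det0P; exists (const_mx 1).
    apply/eqP => /matrixP/(_ 0 (enum_rank z)); rewrite !mxE => /eqP.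
    by rewrite oner_eq0.
  apply/matrixP => i j; rewrite !mxE.
  under eq_bigr => k _ do rewrite !mxE mul1r.
  rewrite sumrB -sumE (bigD1 j) //= eqxx mul1r [X in _ - (_ + X)]big1 ?addr0 ?subrr //.
  by move=> k /negbTE kj; rewrite eq_sym kj mul0r.
pose u s := v 0 (enum_rank s).
have bu : balanced u.
  move=> t; have /matrixP/(_ 0 (enum_rank t)) := vQ; rewrite !mxE.
  under eq_bigr => k _ do rewrite !mxE mulrBr.
  rewrite sumrB => /eqP; rewrite subr_eq0 => /eqP.
  rewrite [RHS](bigD1 (enum_rank t)) //= eqxx mul1r [X in _ + X]big1 => [|k /negbTE ->]; last first.
    by rewrite mul0r mulr0.
  rewrite addr0 enum_rankK => bt; rewrite -[RHS]bt sumE.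
  by apply: eq_bigr => k _; rewrite /u enum_valK.
have bn := balanced_norm bu.
pose T := \sum_s `|u s|.
have T0 : 0 < T.
  rewrite lt_def sumr_ge0 ?andbT //; apply: contra v0 => /eqP T0.
  apply/eqP/matrixP => i j; rewrite ord1 mxE.
  have /(_ (enum_val j) isT) := psumr_eq0P (fun s _ => normr_ge0 (u s)) T0.
  by move=> /normr0_eq0; rewrite /u enum_valK.
exists (fun s => `|u s| / T); split.
- by move=> s; rewrite divr_ge0 // ltW.
- by rewrite -mulr_suml mulfV // gt_eqF.
- move=> t; rewrite mulrAC -bn mulr_suml.
  by apply: eq_bigr => s _; rewrite mulrAC.
Qed.

Variables (z : S) (h : S -> nat).
Hypothesis h_down : forall s, s != z -> exists2 t, 0 < r s t & (h t < h s)%N.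

(** Zeros spread backwards along transitions: a state of weight zero has no inflow, so its
    predecessors have weight zero too. By induction on [h] every state leads to [z]. *)
Lemma subbalanced_eq0 w :
  (forall s, 0 <= w s) -> subbalanced w -> w z = 0 -> forall s, w s = 0.
Proof.
move=> w0 /subbalanced_balanced bw wz s.
have [k le_k] := ubnP (h s); elim: k s le_k => // k IH s le_k.
have [->//|/h_down[t rt ht]] := eqVneq s z.
have wt : w t = 0 by apply: IH; apply: leq_trans ht _.
have := bw t; rewrite wt mul0r.
move/psumr_eq0P => /(_ (fun i _ => mulr_ge0 (w0 i) (r_ge0 i t)) s isT) /eqP.
by rewrite mulf_eq0 (gt_eqF rt) orbF => /eqP.
Qed.

(* The balanced vector |w - c w'|, with c chosen so that it vanishes at z, is zero. *)
Lemma balanced_unique w w' : (forall s, 0 <= w s) -> (forall s, 0 <= w' s) ->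
  \sum_s w s = 1 -> \sum_s w' s = 1 -> balanced w -> balanced w' -> w =1 w'.
Proof.
move=> w0 w'0 sw sw' bw bw'.
have z0 : w' z != 0.
  apply/eqP => z0; have eq0 : forall s, w' s = 0.
    by apply: (subbalanced_eq0 w'0) => // t; rewrite bw'.
  by move/eqP: sw'; rewrite big1 // eq_sym oner_eq0.
pose c := w z / w' z.
have bc : balanced (fun s => w s - c * w' s).
  move=> t; rewrite mulrBl -bw -mulrA -bw' mulr_sumr -sumrB.
  by apply: eq_bigr => s _; rewrite mulrBl mulrA.
have cE s : w s = c * w' s.
  apply/eqP; rewrite -subr_eq0 -normr_eq0; apply/eqP; move: s.
  apply: (@subbalanced_eq0 (fun s => `|w s - c * w' s|)) => [s|t|].
  - exact: normr_ge0.
  - by rewrite (balanced_norm bc).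
  - by rewrite /c mulfVK // subrr normr0.
have c1 : c = 1.
  have : c * \sum_s w' s = \sum_s w s.
    by rewrite mulr_sumr; apply: eq_bigr => s _; rewrite cE.
  by rewrite sw sw' mulr1.
by move=> s; rewrite cE c1 mul1r.
Qed.

End FiniteChain.

(** Exchanging the two sums turns the expected generator into the defects of the balance equations
    integrated against [phi]; indicators of single states give the converse. *)
Lemma balanced_weak (R : realFieldType) (S : finType) (r : S -> S -> R) (w : S -> R) :
  balanced r w <->
  forall phi : S -> R, \sum_s w s * \sum_t r s t * (phi t - phi s) = 0.
Proof.
have swap phi : \sum_s w s * (\sum_t r s t * (phi t - phi s)) =
    \sum_t (\sum_s w s * r s t - w t * \sum_s r t s) * phi t.
  under [RHS]eq_bigr => t _ do rewrite mulrBl mulr_suml.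
  rewrite sumrB exchange_big /= -sumrB; apply: eq_bigr => s _.
  rewrite -mulrA mulr_suml !mulr_sumr -sumrB; apply: eq_bigr => t _; ring.
split=> [bw phi|wk t].
  by rewrite swap big1 // => t _; rewrite bw subrr mul0r.
have := wk (fun s => (s == t)%:R); rewrite swap (bigD1 t) //= eqxx mulr1.
rewrite [X in _ + X]big1 ?addr0 => [/eqP|s /negbTE ->]; last by rewrite mulr0.
by rewrite subr_eq0 => /eqP.
Qed.

(** * Edges, routes and their legs *)

Section Combinatorics.
Local Open Scope set_scope.
Local Open Scope nat_scope.

Lemma card_tuple_family (T : finType) d (F : 'I_d -> {set T}) :
  #|[set c : d.-tuple T | [forall j, tnth c j \in F j]]| = \prod_j #|F j|.
Proof.
have -> : \prod_j #|F j| = #|family (fun j => mem (F j))|.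
  by rewrite card_family foldrE big_map big_enum.
rewrite -[RHS](card_imset _ (can_inj (@tuple_of_finfunK T d))).
apply: eq_card => c; rewrite inE; apply/forallP/imsetP => [cF|[g /familyP gF -> j]].
  exists (finfun_of_tuple c); last by rewrite finfun_of_tupleK.
  by apply/familyP => j; rewrite ffunE; apply: cF.
by rewrite tnth_mktuple; apply: gF.
Qed.

Variable n : nat.
Implicit Types (e f : edge n) (r : route n) (u v w : 'I_n).

Lemma card_val_edge e : #|val e| = 2.
Proof. exact/eqP/(valP e). Qed.

Lemma card_edgeD1 e u : u \in val e -> #|val e :\ u| = 1.
Proof. by move=> ue; have := cardsD1 u (val e); rewrite ue card_val_edge => - []. Qed.

Lemma card_edgeC e : #|~: val e| = n - 2.
Proof.
have : #|val e| + #|~: val e| = n by rewrite cardsC card_ord.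
by rewrite card_val_edge => nE; apply/eqP; rewrite -(eqn_add2l 2) nE subnKC // -nE leq_addr.
Qed.

Lemma mid_notin r : mid r \notin val (ends r).
Proof. exact: (valP r). Qed.

Lemma legsP f r : reflect (exists2 u, u \in val (ends r) & val f = [set u; mid r])
  (f \in legs r).
Proof.
rewrite inE; apply: (iffP existsP) => [[u /andP[ue /eqP fE]]|[u ue fE]].
  by exists u.
by exists u; rewrite ue fE eqxx.
Qed.

Lemma route_eq r r' : ends r = ends r' -> mid r = mid r' -> r = r'.
Proof.
move=> ee mm; apply: val_inj; rewrite (surjective_pairing (val r)).
by rewrite (surjective_pairing (val r')); congr pair.
Qed.

(** A leg meets the pair it serves in exactly one vertex, so its other vertex is the midpoint. Hence
    routes through one edge serve distinct pairs. *)
Lemma legs_ends_inj f r r' : f \in legs r -> f \in legs r' -> ends r = ends r' -> r = r'.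
Proof.
move=> /legsP[u ue fE] /legsP[u' ue' fE'] ee; apply: route_eq => //.
have : mid r \in val f by rewrite fE !inE eqxx orbT.
rewrite fE' !inE => /orP[/eqP mu|/eqP //].
by have := mid_notin r; rewrite mu ee ue'.
Qed.

Lemma card_ends e : #|[set r | ends r == e]| = n - 2.
Proof.
have mid_inj : {in [set r | ends r == e] &, injective (@mid n)}.
  move=> r r'; rewrite !inE => /eqP re /eqP re' mm.
  by apply: route_eq; rewrite ?re ?re'.
rewrite -(card_in_imset mid_inj).
have -> : [set mid r | r in [set r | ends r == e]] = ~: val e.
  apply/finset.setP => w; rewrite inE; apply/imsetP/idP => [[r]|we].
    by rewrite inE => /eqP <- ->; apply: mid_notin.
  by exists (Sub (e, w) we : route n); rewrite ?inE ?eqxx.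
exact: card_edgeC.
Qed.

Lemma card_legs r : #|legs r| = 2.
Proof.
rewrite -(card_imset _ val_inj) -[RHS](card_val_edge (ends r)).
pose g u := [set u; mid r].
have g_inj : {in val (ends r) &, injective g}.
  move=> u v ue ve guv; have : u \in g v by rewrite -guv !inE eqxx.
  rewrite !inE => /orP[/eqP //|/eqP um].
  by have := mid_notin r; rewrite -um ue.
rewrite -(card_in_imset g_inj); apply: eq_card => /= A.
apply/imsetP/imsetP => [[f /legsP[u ue fE] ->]|[u ue ->]].
  by exists u.
have g2 : #|g u| == 2.
  by rewrite cards2; case: (eqVneq u (mid r)) => // um; have := mid_notin r; rewrite -um ue.
by exists (Sub (g u) g2 : edge n) => //; apply/legsP; exists u.
Qed.

(** A route through [f] is given by the end [w] of [f] that is its midpoint and by the vertex [v]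
    outside [f] that it joins to the other end of [f]; [g] is this correspondence. *)
Lemma card_users f : #|[set r | f \in legs r]| = 2 * (n - 2).
Proof.
have -> : 2 * (n - 2) = #|finset.setX (val f) (~: val f)|.
  by rewrite cardsX card_val_edge card_edgeC.
pose g (x : 'I_n * 'I_n) := (x.2 |: (val f :\ x.1), x.1).
have g_inj : {in finset.setX (val f) (~: val f) &, injective g}.
  move=> [w v] [w' v']; rewrite !inE /= => /andP[wf vf] /andP[wf' vf'] [gE ww].
  congr pair => //; have : v \in v' |: (val f :\ w') by rewrite -gE !inE eqxx.
  by rewrite !inE (negbTE vf) andbF orbF => /eqP.
rewrite -(card_in_imset g_inj).
pose g' r := (val (ends r), mid r).
have g'_inj : injective g'.
  by move=> r r' [ee mm]; apply: route_eq => //; apply: val_inj.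
rewrite -(card_imset _ g'_inj); apply: eq_card => x.
apply/imsetP/imsetP => [[r]|[[w v]]]; last first.
  rewrite !inE /= => /andP[wf vf] ->.
  have e2 : #|v |: (val f :\ w)| == 2.
    by rewrite cardsU1 !inE (negbTE vf) andbF card_edgeD1.
  pose e : edge n := Sub (v |: (val f :\ w)) e2.
  have we : w \notin val e.
    by rewrite /= !inE eqxx /= orbF; apply: contraNneq vf => <-.
  exists (Sub (e, w) we : route n) => //; rewrite inE; apply/legsP.
  have /cards1P[u uE] : #|val f :\ w| == 1.
    by rewrite card_edgeD1.
  exists u; first by rewrite /= !inE -[(u != w) && _]finset.in_setD1 uE inE eqxx orbT.
  by rewrite /= finset.setUC -uE /mid /= finset.setD1K.
rewrite inE => /legsP[u ue fE] ->.
have /cards1P[v vE] : #|val (ends r) :\ u| == 1.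
  by rewrite card_edgeD1.
have /finset.setD1P[vu ve] : v \in val (ends r) :\ u by rewrite vE inE.
exists (mid r, v).
  rewrite !inE fE !inE eqxx orbT /= negb_or vu.
  by apply/eqP => vm; have := mid_notin r; rewrite -vm ve.
rewrite /g /g' /=; congr pair; rewrite -{1}(finset.setD1K ue) vE fE.
rewrite finset.setUC; congr finset.setU; apply/finset.setP => y; rewrite !inE.
have um : u != mid r by apply: contraTneq ue => ->; apply: mid_notin.
case: (eqVneq y (mid r)) => [->|_]; last by rewrite orbF.
by rewrite eq_sym (negbTE um).
Qed.

Lemma legs_meet f r : f \in legs r -> exists2 u, u \in val f & u \in val (ends r).
Proof. by move=> /legsP[u ue fE]; exists u; rewrite // fE !inE eqxx. Qed.

Lemma card_star u : #|[set f : edge n | u \in val f]| <= n.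
Proof.
rewrite -(card_imset _ val_inj) -[X in _ <= X]card_ord.
apply: leq_trans (leq_imset_card (fun x => [set u; x]) 'I_n).
apply/subset_leq_card/fintype.subsetP => A /imsetP[f]; rewrite inE => uf ->.
have /cards1P[v vE] : #|val f :\ u| == 1.
  by rewrite card_edgeD1.
by apply/imsetP; exists v => //; rewrite -vE finset.setD1K.
Qed.

Lemma card_edge : #|{: edge n}| = 'C(n, 2).
Proof. by rewrite card_sig -[in RHS](card_ord n) -card_draws cardsE. Qed.

Lemma card_edge_le : #|{: edge n}| <= n * n.
Proof.
by rewrite card_edge bin2; case: (n) => // k; rewrite /= -divn2; lia.
Qed.

End Combinatorics.

(** * The generator of the network *)

Section Network.
Variables (R : realType) (lam mu : R).
Hypotheses (lam_gt0 : 0 < lam) (mu_gt0 : 0 < mu).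
Variables n B d : nat.
Implicit Types (s t : state n B) (e f : edge n) (r : route n) (p q : call_path n).

Lemma add_callE p s q : (s p < B)%N -> add_call p s q = (s q + (q == p))%N :> nat.
Proof.
move=> sp; rewrite ffunE; case: eqVneq => [->|_]; last by rewrite addn0.
by rewrite inordK ?addn1.
Qed.

Lemma del_callE p s q : del_call p s q = (s q - (q == p))%N :> nat.
Proof.
rewrite ffunE; case: eqVneq => [->|_]; last by rewrite subn0.
rewrite subn1 inordK //; apply: leq_ltn_trans (leq_pred _) _; exact: ltn_ord.
Qed.

Lemma alt_load_addl e s f : alt_load (add_call (inl e) s) f = alt_load s f.
Proof. by apply: eq_bigr => r _; rewrite ffunE. Qed.

Lemma alt_load_dell e s f : alt_load (del_call (inl e) s) f = alt_load s f.
Proof. by apply: eq_bigr => r _; rewrite ffunE. Qed.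

Lemma sum_inr_eq r f :
  (\sum_(r' : route n | f \in legs r') ((inr r' : call_path n) == inr r) = (f \in legs r))%N.
Proof.
rewrite big_mkcond (bigD1 r) //= big1 ?addn0 => [|r' /negbTE rr'].
  by rewrite eqxx; case: ifP.
by rewrite (inj_eq (@inr_inj _ _)) rr' if_same.
Qed.

Lemma alt_load_addr r s f : (s (inr r) < B)%N ->
  alt_load (add_call (inr r) s) f = (alt_load s f + (f \in legs r))%N.
Proof.
move=> sr; rewrite -(sum_inr_eq r f) -big_split /=.
by apply: eq_bigr => r' _; rewrite add_callE.
Qed.

Lemma alt_load_delr r s f : (0 < s (inr r))%N ->
  (alt_load (del_call (inr r) s) f + (f \in legs r))%N = alt_load s f.
Proof.
move=> sr; rewrite -(sum_inr_eq r f) -big_split /=.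
apply: eq_bigr => r' _; rewrite del_callE subnK //.
by case: eqVneq => // ->.
Qed.

Lemma leq_alt_load r s f : f \in legs r -> (s (inr r) <= alt_load s f)%N.
Proof. by move=> fr; rewrite /alt_load (bigD1 r) //= leq_addr. Qed.

Lemma available_lt r s : available s r -> (s (inr r) < B)%N.
Proof.
move=> /forallP av; have /card_gt0P[f fr] : (0 < #|legs r|)%N by rewrite card_legs.
by apply: leq_ltn_trans (leq_alt_load s fr) _; have := av f; rewrite fr.
Qed.

Lemma alt_load_del_le p s f : (alt_load (del_call p s) f <= alt_load s f)%N.
Proof. by apply: leq_sum => r _; rewrite del_callE leq_subr. Qed.

Definition next_state (P : policy n B d) s e (c : d.-tuple (route n)) : state n B :=
  oapp (fun p => add_call p s) s (P s e c).

(** The generator, summed over events (an arrival with its draw, or a departure) instead of over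
    target states. *)
Definition gen (P : policy n B d) (phi : state n B -> R) s : R :=
  \sum_(e : edge n) \sum_(c in choices d e)
    lam / #|choices d e|%:R * (phi (next_state P s e c) - phi s)
  + \sum_(p : call_path n) (mu *+ s p) * (phi (del_call p s) - phi s).

Lemma sum_rate (P : policy n B d) (phi : state n B -> R) s :
  \sum_t rate lam mu P s t * (phi t - phi s) = gen P phi s.
Proof.
rewrite /rate; under eq_bigr => t _ do rewrite mulrDl.
rewrite big_split /=; congr (_ + _).
  under eq_bigr => t _ do rewrite mulr_suml.
  rewrite exchange_big /=; apply: eq_bigr => e _.
  under eq_bigr => t _ do rewrite mulr_suml big_mkcondr /=.
  rewrite exchange_big /=; apply: eq_bigr => c _.
  rewrite /next_state; case: (P s e c) => [p|] /=; last first.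
    by rewrite subrr mulr0 big1.
  rewrite (bigD1 (add_call p s)) //= eqxx big1 ?addr0 // => t /negbTE tp.
  by rewrite ifF //; apply/eqP => -[/eqP]; rewrite eq_sym tp.
under eq_bigr => t _ do rewrite mulr_suml big_mkcond /=.
rewrite exchange_big /=; apply: eq_bigr => p _.
rewrite (bigD1 (del_call p s)) //= eqxx big1 ?addr0 // => t /negbTE tp.
by rewrite eq_sym tp.
Qed.

Lemma stationary_ge0 (P : policy n B d) pi s : stationary lam mu P pi -> 0 <= pi s.
Proof. by case. Qed.

Lemma stationary_sum1 (P : policy n B d) pi : stationary lam mu P pi -> \sum_s pi s = 1.
Proof. by case. Qed.

Lemma stationary_feasible (P : policy n B d) pi s :
  stationary lam mu P pi -> pi s != 0 -> feasible s.
Proof. by case=> _ _ pi0 _; apply: contraNT => /pi0 ->. Qed.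

Lemma stationary_gen (P : policy n B d) pi phi : stationary lam mu P pi ->
  \sum_s pi s * gen P phi s = 0.
Proof.
case=> _ _ _ bal; under eq_bigr => s _ do rewrite -sum_rate.
by apply: (proj1 (balanced_weak (rate lam mu P) pi)).
Qed.

Lemma rate_ge0 (P : policy n B d) s t : 0 <= rate lam mu P s t.
Proof.
apply: addr_ge0; apply: sumr_ge0 => x _; last by rewrite mulrn_wge0 // ltW.
by apply: sumr_ge0 => c _; rewrite divr_ge0 // ltW.
Qed.

(** The potential for uniqueness is the number of active calls, which every departure lowers; only
    the empty network has no departures. *)
Lemma rate_down (P : policy n B d) s : s != [ffun=> ord0] ->
  exists2 t, 0 < rate lam mu P s t & (\sum_p t p < \sum_p s p)%N.
Proof.
move=> s0; have [p sp] : exists p, (0 < s p)%N.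
  apply/existsP; apply: contraNT s0; rewrite negb_exists => /forallP s0.
  apply/eqP/ffunP => q; apply: val_inj; rewrite ffunE /=.
  by have := s0 q; rewrite lt0n negbK => /eqP.
exists (del_call p s).
  rewrite /rate (bigD1 p) //= addrCA ltr_wpDr ?mulrn_wgt0 //.
    apply: addr_ge0; apply: sumr_ge0 => x _; last by rewrite mulrn_wge0 // ltW.
    by apply: sumr_ge0 => c _; rewrite divr_ge0 // ltW.
rewrite (bigD1 p) // [X in (_ < X)%N](bigD1 p) //= del_callE eqxx subn1.
rewrite -addSn prednK // leq_add2l; apply: leq_sum => q /negbTE qp.
by rewrite del_callE qp subn0.
Qed.

Lemma feasible_del p s : feasible s -> feasible (del_call p s).
Proof.
move=> /forallP fs; apply/forallP => f.
exact: leq_trans (alt_load_del_le _ _ _) (fs f).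
Qed.

(** A balanced vector exists on all states. As nothing flows from feasible to infeasible states, its
    restriction [w'] to the infeasible ones is subbalanced; it vanishes at the empty network, hence
    everywhere. *)
Lemma stationary_exists (P : policy n B d) :
  (forall s e c p, feasible s -> P s e c = Some p -> feasible (add_call p s)) ->
  exists pi : law R n B, unique (stationary lam mu P) pi.
Proof.
move=> feasP; have rg := rate_ge0 P; have rd := rate_down P.
have [w [w0 sw bw]] := balanced_exists rg ([ffun=> ord0]).
have wI s : ~~ feasible s -> w s = 0.
  pose w' s := if feasible s then 0 else w s.
  suff w'0 : forall s, w' s = 0 by move=> /negbTE Is; have := w'0 s; rewrite /w' Is.
  apply: (subbalanced_eq0 rg rd (w := w')) => [t|t|]; rewrite /w'.
  - by case: ifP.
  - case: ifP => It; first by rewrite mul0r sumr_ge0 // => u _; case: ifP => _; rewrite ?mul0r // mulr_ge0.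
    rewrite -bw ler_sum // => u _; case: ifP => // Fu; rewrite mul0r.
    rewrite /rate [X in _ * X](_ : _ = 0) ?mulr0 //.
    rewrite !big1 ?addr0 // => [p /eqP dp|e _].
      by move: It; rewrite -dp feasible_del.
    apply: big1 => c /andP[_]; case Pc: (P u e c) => [p|] //= /eqP[ap].
    by move: It; rewrite -ap (feasP _ _ _ _ Fu Pc).
  - rewrite ifT //; apply/forallP => f; rewrite /alt_load big1 // => r _.
    by rewrite ffunE.
exists [ffun s => w s]; split.
  split.
  - by move=> s; rewrite ffunE.
  - by rewrite -sw; apply: eq_bigr => s _; rewrite ffunE.
  - by move=> s /wI; rewrite ffunE.
  - move=> t; rewrite ffunE -bw; apply: eq_bigr => s _.
    by rewrite ffunE.
move=> pi [pi0 spi _ bpi]; apply/ffunP => s; rewrite ffunE.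
exact: (balanced_unique rg rd).
Qed.

End Network.

(** * Counting the draws of alternatives *)

Section Choices.
Local Open Scope nat_scope.
Variables n d : nat.
Implicit Types (e : edge n) (c : d.-tuple (route n)).

Lemma choicesE e c :
  (c \in choices d e) = [forall j, tnth c j \in [set r | ends r == e]%SET].
Proof.
rewrite inE; apply/all_tnthP/forallP => H j; have := H j; by rewrite inE.
Qed.

Lemma card_choices_sub e (A : {set route n}) : A \subset [set r | ends r == e]%SET ->
  #|[set c in choices d e | [forall j, tnth c j \in A]]%SET| = #|A| ^ d.
Proof.
move=> /fintype.subsetP sA.
have <- : \prod_(j < d) #|A| = #|A| ^ d by rewrite prod_nat_const card_ord.
rewrite -card_tuple_family; apply: eq_card => c; rewrite [LHS]finset.in_set choicesE [RHS]finset.in_set.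
by apply/andP/idP => [[] //|/forallP cA]; split; apply/forallP => // j; apply: sA.
Qed.

Lemma card_choices e : #|choices d e| = (n - 2) ^ d.
Proof.
rewrite -(card_ends e) -(@card_choices_sub e) //; apply: eq_card => c.
by rewrite finset.in_set choicesE andbb.
Qed.

Lemma card_choices_nth e (A : {set route n}) (j : 'I_d) r :
  r \in A -> A \subset [set r | ends r == e]%SET ->
  #|[set c in choices d e | (tnth c j == r) && [forall i, tnth c i \in A]]%SET|
  = #|A| ^ d.-1.
Proof.
move=> rA /fintype.subsetP sA.
pose F i := if i == j then [set r]%SET else A.
have <- : \prod_(i < d) #|F i| = #|A| ^ d.-1.
  rewrite (bigD1 j) //= /F eqxx cards1 mul1n.
  rewrite (eq_bigr (fun=> #|A|)) => [|i /negbTE -> //].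
  rewrite prod_nat_const; congr (_ ^ _).
  by rewrite (eq_card (_ : _ =i predC1 j)) // cardC1 card_ord.
rewrite -card_tuple_family; apply: eq_card => c; rewrite [LHS]finset.in_set choicesE [RHS]finset.in_set.
apply/and3P/forallP => [[_ /eqP cj /forallP cA] i|cF].
  by rewrite /F; case: eqVneq => [->|_]; rewrite ?cj ?inE.
have cj : tnth c j = r by have := cF j; rewrite /F eqxx inE => /eqP.
have cA i : tnth c i \in A.
  by have := cF i; rewrite /F; case: eqVneq => [->|//]; rewrite cj.
by split; [apply/forallP => i; apply: sA | apply/eqP | apply/forallP].
Qed.

End Choices.

(** * Direct calls as a birth-death chain *)

Section BirthDeath.
Variables (R : realType) (lam mu : R).
Hypotheses (lam_gt0 : 0 < lam) (mu_gt0 : 0 < mu).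
Variable B : nat.
Implicit Types (x y : 'I_B.+1) (xx yy : 'I_B.+1 * 'I_B.+1).

(* At x = B the value of [up] is irrelevant: a jump from x to x does not
   contribute to the generator. *)
Definition up x : 'I_B.+1 := if (x < B)%N then inord x.+1 else x.
Definition down x : 'I_B.+1 := inord x.-1.

Lemma downE x : down x = x.-1 :> nat.
Proof. by rewrite inordK //; apply: leq_ltn_trans (leq_pred _) _. Qed.

Lemma upE x : (x < B)%N -> up x = x.+1 :> nat.
Proof. by move=> xB; rewrite /up xB inordK. Qed.

Definition bd_rate x y : R := lam * (y == up x)%:R + mu *+ x * (y == down x)%:R.
Definition bd_gen (psi : 'I_B.+1 -> R) x : R :=
  lam * (psi (up x) - psi x) + mu *+ x * (psi (down x) - psi x).

Lemma sum_eq_mul (T : finType) (z : T) (F : T -> R) : \sum_y (y == z)%:R * F y = F z.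
Proof.
rewrite (bigD1 z) //= eqxx mul1r big1 ?addr0 // => y /negbTE ->.
by rewrite mul0r.
Qed.

Lemma sum_bd_rate psi x : \sum_y bd_rate x y * (psi y - psi x) = bd_gen psi x.
Proof.
under eq_bigr => y _ do rewrite mulrDl -2!mulrA.
by rewrite big_split /= -!mulr_sumr !sum_eq_mul.
Qed.

Lemma bd_rate_ge0 x y : 0 <= bd_rate x y.
Proof.
by rewrite addr_ge0 // mulr_ge0 ?ler0n ?mulrn_wge0 ?ltW.
Qed.

Lemma bd_rate_down x : (0 < x)%N -> 0 < bd_rate x (down x).
Proof.
move=> x0; rewrite /bd_rate eqxx mulr1 ltr_wpDl ?mulrn_wgt0 //.
by rewrite mulr_ge0 ?ler0n ?ltW.
Qed.

Definition bd2_rate xx yy : R :=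
  bd_rate xx.1 yy.1 * (yy.2 == xx.2)%:R + bd_rate xx.2 yy.2 * (yy.1 == xx.1)%:R.

Lemma sum_bd2_rate psi xx : \sum_yy bd2_rate xx yy * (psi yy - psi xx) =
  bd_gen (fun y => psi (y, xx.2)) xx.1 + bd_gen (fun y => psi (xx.1, y)) xx.2.
Proof.
case: xx => x1 x2 /=; rewrite -!sum_bd_rate.
under eq_bigr => y _ do rewrite mulrDl.
rewrite big_split /=; congr (_ + _).
  under [RHS]eq_bigr => y1 _ do
    rewrite -(sum_eq_mul x2 (fun y2 => bd_rate x1 y1 * (psi (y1, y2) - psi (x1, x2)))).
  rewrite pair_big /=; apply: eq_bigr => -[y1 y2] _ /=; ring.
under [RHS]eq_bigr => y2 _ do
  rewrite -(sum_eq_mul x1 (fun y1 => bd_rate x2 y2 * (psi (y1, y2) - psi (x1, x2)))).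
rewrite exchange_big pair_big /=; apply: eq_bigr => -[y1 y2] _ /=; ring.
Qed.

Lemma bd2_rate_ge0 xx yy : 0 <= bd2_rate xx yy.
Proof. by rewrite addr_ge0 // mulr_ge0 ?ler0n ?bd_rate_ge0. Qed.

Lemma bd2_rate_down xx : xx != (ord0, ord0) ->
  exists2 yy, 0 < bd2_rate xx yy & (yy.1 + yy.2 < xx.1 + xx.2)%N.
Proof.
case: xx => x1 x2 xx0; have [x10|x10] := posnP x1.
  have x20 : (0 < x2)%N.
    rewrite lt0n; apply: contraNneq xx0 => x20.
    by apply/eqP; congr pair; apply: val_inj.
  exists (x1, down x2); last by rewrite /= downE; lia.
  by rewrite /bd2_rate /= eqxx mulr1 ltr_wpDl ?bd_rate_down // mulr_ge0 ?bd_rate_ge0.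
exists (down x1, x2); last by rewrite /= downE; lia.
by rewrite /bd2_rate /= eqxx mulr1 ltr_wpDr ?bd_rate_down // mulr_ge0 ?bd_rate_ge0.
Qed.

(** The product of [m] with itself is balanced for two independent copies of the chain. The pair
    chain can always descend to (0, 0), so its balanced law is unique. *)
Lemma bd2_unique (m : 'I_B.+1 -> R) (w : 'I_B.+1 * 'I_B.+1 -> R) :
  (forall x, 0 <= m x) -> \sum_x m x = 1 -> balanced bd_rate m ->
  (forall xx, 0 <= w xx) -> \sum_xx w xx = 1 ->
  (forall psi, \sum_xx w xx * (bd_gen (fun y => psi (y, xx.2)) xx.1
     + bd_gen (fun y => psi (xx.1, y)) xx.2) = 0) ->
  forall x y, w (x, y) = m x * m y.
Proof.
move=> m0 sm bm w0 sw bw x y.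
pose mm xx := m xx.1 * m xx.2; rewrite -[RHS]/(mm (x, y)).
have bgen psi : \sum_x m x * bd_gen psi x = 0.
  under eq_bigr => z _ do rewrite -sum_bd_rate.
  exact: (proj1 (balanced_weak bd_rate m)).
apply: (balanced_unique bd2_rate_ge0 bd2_rate_down) => //.
- by move=> xx; rewrite mulr_ge0.
- rewrite -(pair_bigA _ (fun x y => m x * m y)) /=.
  under eq_bigr => z _ do rewrite -mulr_sumr sm mulr1.
  by [].
- apply/balanced_weak => psi; under eq_bigr => xx _ do rewrite sum_bd2_rate.
  exact: bw.
- apply/balanced_weak => psi; under eq_bigr => xx _ do rewrite sum_bd2_rate mulrDr.
  rewrite big_split /= -(pair_bigA _ (fun x y => m x * m y * bd_gen (fun z => psi (z, y)) x)).
  rewrite -(pair_bigA _ (fun x y => m x * m y * bd_gen (fun z => psi (x, z)) y)) /=.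
  rewrite exchange_big /= !big1 ?addr0 // => z _.
    under eq_bigr => u _ do rewrite -mulrA.
    by rewrite -mulr_sumr bgen mulr0.
  under eq_bigr => u _ do rewrite [m _ * _]mulrC -mulrA.
  by rewrite -mulr_sumr bgen mulr0.
Qed.

(** Detailed balance: against the indicator of the loads above [j], only jumps between [j] and
    [j.+1] contribute. *)
Lemma bd_cut (m : 'I_B.+1 -> R) : balanced bd_rate m ->
  forall j (jB : (j.+1 < B.+1)%N), mu * j.+1%:R * m (Ordinal jB) = lam * m (inord j).
Proof.
move=> bm j jB; have /(_ (fun x => (j < x)%N%:R)) := proj1 (balanced_weak bd_rate m) bm.
under eq_bigr => z _ do rewrite sum_bd_rate /bd_gen mulrDr.
have jj : (inord j : 'I_B.+1) = j :> nat by rewrite inordK // ltnW.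
rewrite big_split /= (bigD1 (inord j)) //= upE ?jj // ltnSn ltnn subr0 mulr1.
rewrite big1 ?addr0 => [|x xj]; last first.
  have {}xj : x != j :> nat by apply: contra xj => /eqP xj; apply/eqP/val_inj; rewrite /= jj.
  have [xB|xB] := ltnP x B; last by rewrite (_ : up x = x) ?subrr ?mulr0 // /up ltnNge xB.
  by rewrite upE // ltnS leq_eqVlt eq_sym (negbTE xj) subrr !mulr0.
rewrite (bigD1 (Ordinal jB)) //= downE /= ltnn ltnSn sub0r mulrN1.
rewrite big1 ?addr0 => [|x xj]; last first.
  have {}xj : x != j.+1 :> nat by apply: contra xj => /eqP xj; apply/eqP/val_inj.
  rewrite downE [X in X - _](_ : _ = (j < x)%N%:R) ?subrr ?mulr0 //.
  by congr (_%:R); lia.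
by move/eqP; rewrite mulrN subr_eq0 => /eqP /esym; rewrite [lam * _]mulrC => <-; rewrite mulr_natr mulrC.
Qed.

End BirthDeath.

(** * Expectations under a weight *)

Section Mean.
Variables (R : realFieldType) (S : finType) (w : S -> R).

Definition mean (f : S -> R) : R := \sum_s w s * f s.

Lemma eq_mean f g : f =1 g -> mean f = mean g.
Proof. by move=> fg; apply: eq_bigr => s _; rewrite fg. Qed.

Lemma mean_sum (I : finType) (P : pred I) (F : I -> S -> R) :
  mean (fun s => \sum_(i | P i) F i s) = \sum_(i | P i) mean (F i).
Proof. by rewrite /mean exchange_big; apply: eq_bigr => s _; rewrite mulr_sumr. Qed.

Lemma meanD f g : mean (fun s => f s + g s) = mean f + mean g.
Proof. by rewrite /mean -big_split; apply: eq_bigr => s _; rewrite mulrDr. Qed.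

Lemma meanZ a f : mean (fun s => a * f s) = a * mean f.
Proof. by rewrite /mean mulr_sumr; apply: eq_bigr => s _; rewrite mulrCA. Qed.

Lemma meanB f g : mean (fun s => f s - g s) = mean f - mean g.
Proof. by rewrite /mean -sumrB; apply: eq_bigr => s _; rewrite mulrBr. Qed.

Hypothesis w_ge0 : forall s, 0 <= w s.

Lemma mean_le f g : (forall s, w s != 0 -> f s <= g s) -> mean f <= mean g.
Proof.
move=> fg; apply: ler_sum => s _; have [->|ws] := eqVneq (w s) 0.
  by rewrite !mul0r.
by rewrite ler_wpM2l ?fg.
Qed.

Lemma mean_ge0 f : (forall s, 0 <= f s) -> 0 <= mean f.
Proof. by move=> f0; apply: sumr_ge0 => s _; rewrite mulr_ge0. Qed.

Hypothesis w_sum : \sum_s w s = 1.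

Lemma mean_cst a : mean (fun=> a) = a.
Proof. by rewrite /mean -mulr_suml w_sum mul1r. Qed.

End Mean.

(* Downward from B, x (B - i) <= (i + 1) k^i y. *)
Lemma sum1_geometric_bound (R : realFieldType) (B : nat) (k y : R) (x : nat -> R) :
  1 <= k -> 0 <= y -> \sum_(j < B.+1) x j = 1 -> x B <= y ->
  (forall j, (j < B)%N -> x j <= y + k * x j.+1) ->
  1 <= B.+1%:R ^+ 2 * k ^+ B * y.
Proof.
move=> k1 y0 sx xB xS.
have k0 : 0 <= k := le_trans ler01 k1.
have xi i : (i <= B)%N -> x (B - i)%N <= i.+1%:R * k ^+ i * y.
  elim: i => [|i IH] iB; first by rewrite subn0 expr0 mulr1 mul1r.
  have := xS (B - i.+1)%N; rewrite ltn_subrL (leq_trans _ iB) // => /(_ isT).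
  rewrite subnSK // => /le_trans; apply.
  apply: (@le_trans _ _ (y + k * (i.+1%:R * k ^+ i * y))).
    by rewrite lerD2l ler_wpM2l // IH // ltnW.
  rewrite -[i.+2]addn1 natrD mulrDl mulrDl addrC mulrCA exprS !mulrA mul1r.
  rewrite lerD //; first by rewrite mulrAC -!mulrA; lra.
  by rewrite ler_peMl // -exprS exprn_ege1.
have -> : B.+1%:R ^+ 2 * k ^+ B * y = \sum_(j < B.+1) (B.+1%:R * (k ^+ B * y)).
  by rewrite sumr_const card_ord -[RHS]mulr_natl; ring.
rewrite -{1}sx; apply: ler_sum => j _.
have jB : (j <= B)%N by rewrite -ltnS.
rewrite -(subKn jB); apply: le_trans (xi _ (leq_subr _ _)) _.
rewrite -mulrA ler_pM ?ler0n ?mulr_ge0 ?exprn_ge0 ?ler_nat ?ltnS ?leq_subr //.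
by rewrite ler_wpM2r // ler_weXn2l // leq_subr.
Qed.

(** * Direct loads under DAR: pairwise independence and concentration *)

Section DirectCalls.
Variables (R : realType) (lam mu : R).
Hypotheses (lam_gt0 : 0 < lam) (mu_gt0 : 0 < mu).
Variables n B d : nat.
Hypothesis n_gt2 : (2 < n)%N.
(** The policy draws [D] alternatives, so there is always a first one; the exponent [d] below is one
    less than the number of draws. *)
Local Notation D := d.+1.
Variable pi : law R n B.
Hypothesis pi_st : stationary lam mu (@dar n B D) pi.
Implicit Types (s t : state n B) (e f : edge n) (r : route n).

Let pi_ge0 s : 0 <= pi s.
Proof. exact: stationary_ge0 pi_st. Qed.

Let pi_sum : \sum_s pi s = 1.
Proof. exact: stationary_sum1 pi_st. Qed.

Lemma choices_gt0 e : (0 < #|choices D e|)%N.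
Proof. by rewrite card_choices expn_gt0 subn_gt0 n_gt2. Qed.

(** Whatever the alternative calls do, an arrival on [e] raises the direct load of [e] unless that
    link is full, and overflow or rejection leaves all direct loads unchanged. *)
Lemma dar_gen_direct psi e e' s : e != e' ->
  gen lam mu (@dar n B D) (fun s => psi (s (inl e), s (inl e'))) s =
  bd_gen lam mu (fun y => psi (y, s (inl e'))) (s (inl e)) +
  bd_gen lam mu (fun y => psi (s (inl e), y)) (s (inl e')).
Proof.
move=> ee'; have e'e : e' != e by rewrite eq_sym.
rewrite /gen /bd_gen addrACA; congr (_ + _).
  have nxt e0 c : next_state (@dar n B D) s e0 c (inl e) = (if e0 == e then up (s (inl e)) else s (inl e))
    /\ next_state (@dar n B D) s e0 c (inl e') = (if e0 == e' then up (s (inl e')) else s (inl e')).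
    rewrite /next_state /dar /up; case: ifP => sB /=.
      rewrite !ffunE !(inj_eq (@inl_inj _ _)) !(eq_sym _ e0).
      by split; case: eqVneq => // <-; rewrite ?sB.
    split; (case: (ohead _) => [r|] /=; rewrite ?ffunE /=;
      by case: eqVneq => // <-; rewrite sB).
  pose Del e0 := psi (if e0 == e then up (s (inl e)) else s (inl e),
      if e0 == e' then up (s (inl e')) else s (inl e')) - psi (s (inl e), s (inl e')).
  transitivity (\sum_e0 lam * Del e0).
    apply: eq_bigr => e0 _; rewrite (eq_bigr (fun=> lam / #|choices D e0|%:R * Del e0)).
      rewrite sumr_const -[LHS]mulr_natl mulrA mulrCA mulfV ?mulr1 // pnatr_eq0.
      by rewrite -lt0n choices_gt0.
    by move=> c _; rewrite (nxt e0 c).1 (nxt e0 c).2.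
  rewrite (bigD1 e) //= (bigD1 e') //= /Del !eqxx (negbTE ee') (negbTE e'e).
  rewrite big1 ?addr0 // => e0 /andP[/negbTE -> /negbTE ->].
  by rewrite subrr mulr0.
rewrite (bigD1 (inl e)) //= (bigD1 (inl e')) //=.
rewrite !ffunE !eqxx !(inj_eq (@inl_inj _ _)) (negbTE ee') (negbTE e'e).
rewrite big1 ?addr0 // => p /andP[pe pe'].
by rewrite !ffunE !(eq_sym _ p) (negbTE pe) (negbTE pe') subrr mulr0.
Qed.

Variable m : 'I_B.+1 -> R.
Hypotheses (m_ge0 : forall x, 0 <= m x) (m_sum : \sum_x m x = 1).
Hypothesis m_bal : balanced (bd_rate lam mu (B := B)) m.

(** The joint law [w] of the two direct loads satisfies the weak balance equations of the pair
    chain, so it is the product law. *)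
Lemma dar_pair_law e e' x y : e != e' ->
  mean pi (fun s => ((s (inl e) == x) && (s (inl e') == y))%:R) = m x * m y.
Proof.
move=> ee'.
pose w (xx : 'I_B.+1 * 'I_B.+1) : R :=
  mean pi (fun s => (xx == (s (inl e), s (inl e')))%:R).
have wE g : \sum_xx w xx * g xx = mean pi (fun s => g (s (inl e), s (inl e'))).
  rewrite /w /mean; under eq_bigr => xx _ do rewrite mulr_suml.
  rewrite exchange_big /=; apply: eq_bigr => s _.
  by under eq_bigr => xx _ do rewrite -mulrA; rewrite -mulr_sumr sum_eq_mul.
rewrite -(bd2_unique lam_gt0 mu_gt0 m_ge0 m_sum m_bal (w := w)).
- by apply: eq_mean => s; rewrite xpair_eqE !(eq_sym (s _)).
- by move=> xx; apply: mean_ge0 => [s|s]; rewrite ?pi_ge0 ?ler0n.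
- under eq_bigr => xx _ do rewrite -[w xx]mulr1.
  by rewrite (wE (fun=> 1)) mean_cst // pi_sum.
- move=> psi; rewrite (wE (fun xx => bd_gen lam mu (fun y => psi (y, xx.2)) xx.1 +
    bd_gen lam mu (fun y => psi (xx.1, y)) xx.2)) /mean.
  under eq_bigr => s _ do rewrite /= -dar_gen_direct //.
  exact: stationary_gen pi_st.
Qed.

Lemma dar_single_law e x : mean pi (fun s => (s (inl e) == x)%:R) = m x.
Proof.
(* The marginal is read off the pair law, which takes a second edge: a leg of any route between the
   ends of [e]. *)
have [e' ee'] : exists e', e != e'.
  have /card_gt0P[r] : (0 < #|[set r : route n | ends r == e]|)%N.
    by rewrite card_ends subn_gt0.
  rewrite inE => /eqP re; have /card_gt0P[f fr] : (0 < #|legs r|)%N by rewrite card_legs.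
  exists f; apply: contraNneq (mid_notin r) => ef; rewrite re ef.
  by have /legsP[u _ ->] := fr; rewrite !inE eqxx orbT.
transitivity (\sum_y m x * m y); last by rewrite -mulr_sumr m_sum mulr1.
under eq_bigr => y _ do rewrite -(dar_pair_law x y ee').
rewrite -mean_sum; apply: eq_mean => s.
rewrite (bigD1 (s (inl e'))) //= eqxx andbT big1 ?addr0 // => y /negbTE sy.
by rewrite [X in _ && X]eq_sym sy andbF.
Qed.

(** Since a pair has at most one route through [f], this counts the pairs with a full direct link
    that may use [f] as a leg. *)
Definition saturated f s : R :=
  \sum_(r | f \in legs r) (s (inl (ends r)) == ord_max)%:R.

Lemma saturated_mean f : mean pi (saturated f) = (2 * (n - 2))%:R * m ord_max.
Proof.
rewrite mean_sum; under eq_bigr => r _ do rewrite dar_single_law.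
by rewrite sumr_const -[LHS]mulr_natl -(card_users f) cardsE.
Qed.

(** The indicators in [saturated] belong to distinct pairs, so they are pairwise independent, and
    the variance of their sum is at most its mean. *)
Lemma saturated_var f a : a = (2 * (n - 2))%:R * m ord_max ->
  mean pi (fun s => (saturated f s - a) ^+ 2) <= a.
Proof.
move=> aE; set p := m ord_max.
have sq s : (saturated f s - a) ^+ 2 = saturated f s ^+ 2 - (2 * a) * saturated f s + a ^+ 2.
  by ring.
rewrite (eq_mean _ sq) meanD meanB meanZ saturated_mean mean_cst ?pi_sum //.
rewrite -aE.
have -> : mean pi (fun s => saturated f s ^+ 2) =
   \sum_(r | f \in legs r) \sum_(r' | f \in legs r')
     (if r == r' then p else p * p).
  transitivity (mean pi (fun s => \sum_(r | f \in legs r) \sum_(r' | f \in legs r')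
      ((s (inl (ends r)) == ord_max) && (s (inl (ends r')) == ord_max))%:R)).
    apply: eq_mean => s; rewrite expr2 mulr_suml; apply: eq_bigr => r _.
    by rewrite mulr_sumr; apply: eq_bigr => r' _; rewrite -natrM mulnb.
  rewrite mean_sum; apply: eq_bigr => r fr; rewrite mean_sum; apply: eq_bigr => r' fr'.
  case: eqVneq => [->|rr'].
    by under eq_mean => s do rewrite andbb; rewrite dar_single_law.
  rewrite dar_pair_law //; apply: contra rr' => /eqP ee; apply/eqP.
  exact: legs_ends_inj fr fr' ee.
apply: (@le_trans _ _ (\sum_(r | f \in legs r) (p + a * p) - 2 * a * a + a ^+ 2)).
  rewrite lerD2r lerD2r; apply: ler_sum => r fr.
  have -> : a * p = \sum_(r' | f \in legs r') p * p.
    by rewrite sumr_const -[RHS]mulr_natl -cardsE card_users aE mulrA.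
  rewrite (bigD1 r) //= eqxx lerD2l [leRHS](bigD1 r) //= .
  apply: (@le_trans _ _ (\sum_(r' | (f \in legs r') && (r' != r)) p * p)).
    by apply: ler_sum => r' /andP[_ /negbTE]; rewrite eq_sym => ->.
  by rewrite lerDr mulr_ge0 // /p.
rewrite sumr_const -[X in X - _ + _]mulr_natl -cardsE card_users mulrDr mulrCA -aE.
rewrite le_eqVlt; apply/orP; left; apply/eqP; ring.
Qed.

(* Integrate g K >= g a / 2 - (K - a)^2 / (2 a), where K is [saturated f] and a its mean. *)
Lemma saturated_corr f (g : state n B -> R) : 0 < m ord_max ->
  (forall s, 0 <= g s <= 1) ->
  (n - 2)%:R * m ord_max * mean pi g - 2^-1 <= mean pi (fun s => g s * saturated f s).
Proof.
move=> p0 g01; set p := m ord_max in p0 *.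
pose a := (2 * (n - 2))%:R * p.
have a0 : 0 < a by rewrite mulr_gt0 // ltr0n muln_gt0 subn_gt0.
apply: (@le_trans _ _ (mean pi (fun s => a / 2 * g s - (2 * a)^-1 * (saturated f s - a) ^+ 2))).
  rewrite meanB !meanZ; apply: lerB.
    by rewrite /a natrM; rewrite le_eqVlt; apply/orP; left; apply/eqP; field.
  have := ler_wpM2l (_ : 0 <= (2 * a)^-1) (saturated_var f (erefl a)).
  rewrite invr_ge0 => /(_ (mulr_ge0 (ler0n _ _) (ltW a0))) /le_trans; apply.
  by rewrite -/p -/a invfM mulfVK ?gt_eqF.
apply: (mean_le pi_ge0) => s _.
have /andP[g0 g1] := g01 s; set K := saturated f s; set x := K - a.
have x0 : 0 <= (2 * a)^-1 * x ^+ 2.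
  by rewrite mulr_ge0 ?sqr_ge0 // invr_ge0 mulr_ge0 // ltW.
have K0 : 0 <= K - a / 2 + (2 * a)^-1 * x ^+ 2.
  have -> : K - a / 2 + (2 * a)^-1 * x ^+ 2 = (2 * a)^-1 * K ^+ 2.
    rewrite /x; field; exact: lt0r_neq0.
  by rewrite mulr_ge0 ?sqr_ge0 // invr_ge0 mulr_ge0 // ltW.
have := mulr_ge0 g0 K0; have := ler_piMl x0 g1; rewrite -/x.
set y := _ * x ^+ 2; nra.
Qed.

End DirectCalls.

(** * Lower bound on the capacity for DAR *)

Section AlternativeCalls.
Variables (R : realType) (lam mu : R).
Hypotheses (lam_gt0 : 0 < lam) (mu_gt0 : 0 < mu).
Variables n B d : nat.
Hypothesis n_gt2 : (2 < n)%N.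
Local Notation D := d.+1.
Variable pi : law R n B.
Hypothesis pi_st : stationary lam mu (@dar n B D) pi.
Implicit Types (s t : state n B) (e f : edge n) (r : route n).

Let pi_ge0 s : 0 <= pi s.
Proof. exact: stationary_ge0 pi_st. Qed.

Let pi_sum : \sum_s pi s = 1.
Proof. exact: stationary_sum1 pi_st. Qed.

Let N : R := (n - 2)%:R.

Let N_gt0 : 0 < N.
Proof. by rewrite ltr0n subn_gt0. Qed.

Lemma dar_first e c s : c \in choices D e -> s (inl e) = ord_max ->
  available s (tnth c ord0) -> @dar n B D s e c = Some (inr (tnth c ord0)).
Proof.
case/tupleP: c => r c _ sB av; rewrite /dar sB ltnn /=.
by rewrite tnth0 in av *; rewrite av.
Qed.

Lemma card_choices_first r :
  #|[set c in choices D (ends r) | tnth c ord0 == r]%SET| = ((n - 2) ^ d)%N.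
Proof.
have rA : r \in [set r' | ends r' == ends r]%SET by rewrite inE.
have := card_choices_nth (ord0 : 'I_D) rA (subxx _).
rewrite card_ends /= => <-.
have allA (c : D.-tuple (route n)) : (c \in choices D (ends r)) && (tnth c ord0 == r) =
  (c \in choices D (ends r)) &&
  ((tnth c ord0 == r) && [forall i, tnth c i \in [set r' | ends r' == ends r]%SET]).
  by case: (boolP (c \in choices D (ends r))) => [|_] //; rewrite choicesE => ->; rewrite andbT.
by apply: eq_card => c; rewrite [LHS]finset.in_set [RHS]finset.in_set allA.
Qed.

(** Only calls between the ends of [r] can draw [r], and their first draw is [r] with probability 1
    / (n - 2). *)
Lemma sum_first_choice r :
  \sum_e \sum_(c in choices D e) lam / #|choices D e|%:R * (tnth c ord0 == r)%:R = lam / N.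
Proof.
rewrite (bigD1 (ends r)) //= [X in _ + X]big1 ?addr0 => [|e er]; last first.
  rewrite big1 // => c; rewrite choicesE => /forallP /(_ ord0); rewrite inE => /eqP ce.
  suff /negbTE -> : tnth c ord0 != r by rewrite mulr0.
  by apply: contraNneq er => <-; rewrite ce.
rewrite -mulr_sumr -natr_sum -big_mkcondr /= sum1dep_card card_choices_first.
have Nd : ((n - 2) ^ d)%:R != 0 :> R by rewrite pnatr_eq0 -lt0n expn_gt0 subn_gt0 n_gt2.
by rewrite card_choices expnS natrM -/N invfM mulrA mulfVK.
Qed.

Lemma alt_load_next_ge s e c f :
  (alt_load s f <= alt_load (next_state (@dar n B D) s e c) f)%N.
Proof.
rewrite /next_state /dar; case: ifP => _ /=; first by rewrite alt_load_addl.
case E: (ohead _) => [r|] //=.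
rewrite alt_load_addr ?leq_addr // available_lt //.
by have := filter_all (available s) c; case: (seq.filter _ _) E => //= a l [->] /andP[].
Qed.

(** Only those arrivals are kept whose direct link is full and whose first alternative is an
    available route through [f]: they surely take it. No arrival lowers a load, and the downward
    crossing rate is exactly mu (j + 1) times the indicator of load j + 1. *)
Lemma dar_cut_gen f j s :
  lam / N * \sum_(r | f \in legs r) ((alt_load s f == j) && (s (inl (ends r)) == ord_max)
     && available s r)%:R - mu * j.+1%:R * (alt_load s f == j.+1)%:R
  <= gen lam mu (@dar n B D) (fun s => (j < alt_load s f)%N%:R) s.
Proof.
rewrite /gen; apply: lerD.
  rewrite mulr_sumr; under eq_bigr => r _ do rewrite -(sum_first_choice r) mulr_suml.
  rewrite exchange_big /=; apply: ler_sum => e _.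
  under eq_bigr => r _ do rewrite mulr_suml.
  rewrite exchange_big /=; apply: ler_sum => c ce.
  under eq_bigr => r _ do rewrite -mulrA.
  rewrite -mulr_sumr; apply: ler_wpM2l; first by rewrite divr_ge0 // ltW.
  set X := alt_load s f.
  have XX := alt_load_next_ge s e c f.
  rewrite big_mkcond (bigD1 (tnth c ord0)) //= big1 ?addr0 => [|r rc]; last first.
    by rewrite eq_sym (negbTE rc) mul0r if_same.
  rewrite eqxx mul1r; set Y := alt_load (next_state _ _ _ _) f.
  have dif : 0 <= (j < Y)%N%:R - (j < X)%N%:R :> R.
    by rewrite subr_ge0 ler_nat; case: (ltnP j X) => // jX; rewrite (leq_trans jX XX).
  case: ifP => // fr; have [Xj|//] := eqVneq X j.
  have [sB|//] := eqVneq (s (inl (ends (tnth c ord0)))) ord_max.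
  case: (boolP (available s _)) => //= av.
  have ce0 : ends (tnth c ord0) = e.
    by move: ce; rewrite choicesE => /forallP /(_ ord0); rewrite inE => /eqP.
  rewrite ce0 in sB; rewrite /Y /next_state (dar_first ce sB av) /=.
  by rewrite alt_load_addr ?available_lt // fr addn1 -/X Xj ltnSn ltnn subr0.
rewrite big_sumType /= big1 ?add0r => [|e _]; last first.
  by rewrite alt_load_dell subrr mulr0.
have [Xj|Xj] := eqVneq (alt_load s f) j.+1; last first.
  rewrite mulr0 oppr0 big1 // => r _.
  have [s0|s0] := posnP (s (inr r)); first by rewrite s0 mulr0n mul0r.
  have := alt_load_delr f s0; set Y := alt_load (del_call _ _) f => YX.
  rewrite (_ : (j < Y)%N = (j < alt_load s f)%N) ?subrr ?mulr0 //.
  by move: YX Xj; case: (f \in legs r); lia.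
have -> : mu * j.+1%:R = \sum_(r | f \in legs r) mu *+ s (inr r).
  by rewrite sumrMnr mulr_natr -Xj.
rewrite mulr1 -sumrN big_mkcond /=; apply: ler_sum => r _.
have [s0|s0] := posnP (s (inr r)); first by rewrite s0 mulr0n mul0r oppr0 if_same.
have := alt_load_delr f s0; rewrite Xj ltnSn; case: ifP => fr.
  by rewrite addn1 => -[->]; rewrite ltnn sub0r mulrN1.
by rewrite addn0 => ->; rewrite ltnSn subrr mulr0.
Qed.

Definition blocked s r := (s (inl (ends r)) == ord_max) && ~~ available s r.

Let E : R := #|{: edge n}|%:R.

(* The rejection probability of a call with full direct link is U^d, where U is the
   fraction of its routes that are unavailable, and U <= tau + U^d / tau^(d-1). *)
Lemma loss_prob_blocked (tau : R) : 0 < tau ->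
  mean pi (fun s => \sum_r (blocked s r)%:R) / (E * N)
  <= tau + loss_prob (@dar n B D) pi / tau ^+ d.
Proof.
move=> tau0; have E_gt0 : 0 < E by rewrite ltr0n card_edge bin_gt0 ltnW.
pose U s e : R := #|[set r | (ends r == e) && ~~ available s r]%SET|%:R / N.
pose L s e : R := #|[set c in choices D e | dar s e c == None]%SET|%:R / #|choices D e|%:R.
have U0 s e : 0 <= U s e by apply: divr_ge0 => //; exact: ltW.
have L0 s e : 0 <= L s e by apply: divr_ge0.
have UL s e : s (inl e) = ord_max -> L s e = U s e ^+ D.
  move=> sB; rewrite expr_div_n -natrX -(@card_choices_sub _ D e); last first.
    by apply/fintype.subsetP => r; rewrite !inE => /andP[].
  rewrite /L card_choices natrX; congr (_%:R / _); apply: eq_card => c.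
  rewrite finset.in_set [RHS]finset.in_set; case: (boolP (c \in _)) => //= ce.
  rewrite /dar sB ltnn; apply/idP/forallP => [Hc j|Hc].
    have cj : ends (tnth c j) == e by move: ce; rewrite choicesE => /forallP /(_ j); rewrite inE.
    rewrite inE cj /=; apply/negP => av.
    have : tnth c j \in [seq r <- c | available s r] by rewrite mem_filter av mem_tnth.
    by case: (seq.filter _ _) Hc.
  rewrite (_ : seq.filter _ _ = [::]) //; apply/eqP; rewrite -size_eq0 size_filter -leqn0 leqNgt -has_count.
  apply/hasPn => r /tnthP[j ->]; have := Hc j.
  by rewrite inE => /andP[].
have pt s e : \sum_(r | ends r == e) (blocked s r)%:R / N <= tau + L s e / tau ^+ d.
  have [sB|sB] := eqVneq (s (inl e)) ord_max; last first.
    rewrite big1 => [|r /eqP re]; last by rewrite /blocked re (negbTE sB) mul0r.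
    by apply: addr_ge0; [exact: ltW | apply: divr_ge0; rewrite // exprn_ge0 // ltW].
  have -> : \sum_(r | ends r == e) (blocked s r)%:R / N = U s e.
    rewrite -mulr_suml -natr_sum; congr (_%:R / _).
    rewrite -sum1_card [RHS](eq_bigl (fun r => (ends r == e) && ~~ available s r)); last first.
      by move=> r; rewrite inE.
    rewrite big_mkcondr /=; apply: eq_bigr => r /eqP re.
    by rewrite /blocked re sB eqxx; case: available.
  rewrite UL //; have [Ut|/ltW Ut] := lerP (U s e) tau.
    rewrite (le_trans Ut) // lerDl; apply: divr_ge0; apply: exprn_ge0 => //; exact: ltW.
  apply: (@le_trans _ _ (U s e ^+ D / tau ^+ d)); last by rewrite lerDr ltW.
  rewrite exprS -mulrA; apply: ler_peMr => //; rewrite -expr_div_n exprn_ege1 //.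
  by rewrite ler_pdivlMr // mul1r.
have pts s : (\sum_r (blocked s r)%:R) / (E * N) <= tau + (\sum_e L s e) / E / tau ^+ d.
  have -> : tau + (\sum_e L s e) / E / tau ^+ d = (\sum_e (tau + L s e / tau ^+ d)) / E.
    have cst : \sum_(e : edge n) tau = E * tau by rewrite sumr_const mulr_natl.
    rewrite big_split /= cst -mulr_suml mulrDl; congr (_ + _); last by rewrite mulrAC.
    by rewrite mulrAC mulfV ?gt_eqF // mul1r.
  rewrite invfM [E^-1 * _]mulrC mulrA ler_pM2r ?invr_gt0 //.
  rewrite mulr_suml (partition_big (@ends n) predT) //=.
  by apply: ler_sum => e _; apply: pt.
have -> : mean pi (fun s => \sum_r (blocked s r)%:R) / (E * N) =
    mean pi (fun s => (\sum_r (blocked s r)%:R) / (E * N)).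
  by rewrite /mean mulr_suml; apply: eq_bigr => s _; rewrite mulrA.
apply: (@le_trans _ _ (mean pi (fun s => tau + (\sum_e L s e) / E / tau ^+ d))).
  by apply: (mean_le pi_ge0) => s _; apply: pts.
rewrite meanD mean_cst ?pi_sum // lerD2l /loss_prob /mean mulr_suml.
by apply: ler_sum => s _; rewrite mulrA.
Qed.

End AlternativeCalls.

(** * The recursion for alternative loads under DAR *)

Lemma sqrn_add2E b : (b.+2 ^ 2 = 2 + (b.+3 * b + b.+2))%N.
Proof. by rewrite -mulnn; lia. Qed.

Section DarLowerBound.
Variables (R : realType) (lam mu : R).
Hypotheses (lam_gt0 : 0 < lam) (mu_gt0 : 0 < mu).
Variables n B d : nat.
Hypothesis n_gt2 : (2 < n)%N.
Local Notation D := d.+1.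
Variable pi : law R n B.
Hypothesis pi_st : stationary lam mu (@dar n B D) pi.
Implicit Types (s t : state n B) (e f : edge n) (r : route n).

Let N : R := (n - 2)%:R.
Let E : R := #|{: edge n}|%:R.
(** Small enough that its inverse bounds both mu (j + 1) / lam for j < B and B + 1, so that all
    prefactors become powers of [beta]. *)
Let beta : R := Num.min 1 (lam / mu) / B.+1%:R.

Let N_gt0 : 0 < N.
Proof. by rewrite ltr0n subn_gt0. Qed.

Let E_gt0 : 0 < E.
Proof. by rewrite ltr0n card_edge bin_gt0 ltnW. Qed.

Let beta_gt0 : 0 < beta.
Proof. by rewrite divr_gt0 ?ltr0n // lt_min ltr01 divr_gt0. Qed.

Let beta_le : beta <= B.+1%:R^-1.
Proof. by rewrite ler_piMl ?invr_ge0 // ge_min lexx. Qed.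

Let beta_le1 : beta <= 1.
Proof. by apply: le_trans beta_le _; rewrite invf_le1 ?ltr0n // ler1n. Qed.

Let beta_ratio j : (j < B)%N -> mu * j.+1%:R / lam <= beta^-1.
Proof.
move=> jB; rewrite /beta invf_div; set t := Num.min _ _.
have t0 : 0 < t by rewrite lt_min ltr01 divr_gt0.
have tl : mu * t <= lam by rewrite mulrC -ler_pdivlMr // ge_min lexx orbT.
rewrite ler_pdivrMr // mulrAC ler_pdivlMr // mulrAC [leRHS]mulrC.
apply: ler_pM => //; first by rewrite mulr_ge0 // ltW.
by rewrite ler_nat ltnS ltnW.
Qed.

Variable m : 'I_B.+1 -> R.
Hypotheses (m_ge0 : forall x, 0 <= m x) (m_sum : \sum_x m x = 1).
Hypothesis m_bal : balanced (bd_rate lam mu (B := B)) m.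
Let p := m ord_max.

(** Detailed balance bounds each m(j) by m(j + 1) / beta. The masses sum to 1, so 1 <= (B + 1)^2
    beta^(-B) p, and two more powers of [beta] absorb (B + 1)^2. *)
Lemma full_ge : beta ^+ B.+2 <= p.
Proof.
have : 1 <= B.+1%:R ^+ 2 * beta^-1 ^+ B * p.
  apply: (sum1_geometric_bound (x := fun j => m (inord j))).
  - by rewrite invf_ge1.
  - exact: m_ge0.
  - by rewrite -[RHS]m_sum; apply: eq_bigr => j _; rewrite inord_val.
  - by rewrite le_eqVlt; apply/orP; left; apply/eqP; congr m; apply: val_inj; rewrite /= inordK.
  - move=> j jB; have jB' : (j.+1 < B.+1)%N by [].
    have := bd_cut lam_gt0 mu_gt0 m_bal jB'; rewrite (_ : inord j.+1 = Ordinal jB'); last first.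
      by apply: val_inj; rewrite /= inordK.
    move=> cut; have -> : m (inord j) = mu * j.+1%:R / lam * m (Ordinal jB').
      by rewrite mulrAC cut mulrAC mulfV ?mul1r // gt_eqF.
    apply: le_trans (ler_wpM2r (m_ge0 _) (beta_ratio jB)) _.
    by rewrite lerDr m_ge0.
rewrite exprVn mulrAC ler_pdivlMr ?exprn_gt0 // mul1r => H.
rewrite -addn2 exprD -ler_pdivlMr ?exprn_gt0 //; apply: le_trans H _.
rewrite mulrC ler_wpM2l //; first exact: m_ge0.
by rewrite -exprVn lerXn2r ?nnegrE ?ler0n ?invr_ge0 ?(ltW beta_gt0) // -[leLHS]invrK lef_pV2 ?posrE ?invr_gt0 ?ltr0n.
Qed.

(** With x_j the expected fraction of edges of alternative load j, the flow between consecutive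
    loads gives x_j <= eps / p + x_(j+1) / (beta p), while p x_B <= eps. As the x_j sum to 1, [eps]
    cannot be too small. *)
Lemma dar_core (tau : R) : 0 < tau ->
  beta ^+ (B.+2 ^ 2) <= (2 * N)^-1 + 2 * (tau + loss_prob (@dar n B D) pi / tau ^+ d).
Proof.
move=> tau0; set q := tau + _.
have p_gt0 : 0 < p := lt_le_trans (exprn_gt0 _ beta_gt0) full_ge.
pose x j := mean pi (fun s => \sum_f (alt_load s f == j)%:R) / E.
(* The first term is the 1/2 lost in [saturated_corr], divided by [N]; the factor 2 in the second
   appears because a blocked route is counted at both its legs. *)
set eps := _ + _.
have blocked_le : mean pi (fun s => \sum_r (blocked s r)%:R) <= E * N * q.
  rewrite mulrC -ler_pdivrMr ?mulr_gt0 //; exact: (loss_prob_blocked n_gt2 pi_st tau0).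
have q0 : 0 <= q.
  rewrite -(pmulr_rge0 _ (mulr_gt0 E_gt0 N_gt0)); apply: le_trans blocked_le.
  by apply: mean_ge0 => [s|s]; [exact: stationary_ge0 pi_st | apply: sumr_ge0].
have eps0 : 0 <= eps.
  by rewrite addr_ge0 ?invr_ge0 ?mulr_ge0 // ltW.
have sat_ge j : E * (N * (p * x j) - 2^-1) <=
    mean pi (fun s => \sum_f (alt_load s f == j)%:R * saturated R f s).
  rewrite /x; set S := mean pi _.
  have -> : E * (N * (p * (S / E)) - 2^-1) = N * p * S - E * 2^-1.
    by field; exact: lt0r_neq0.
  rewrite /S !mean_sum.
  have -> : E * 2^-1 = \sum_(f : edge n) 2^-1 by rewrite sumr_const mulr_natl.
  rewrite mulr_sumr -sumrB; apply: ler_sum => f _.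
  apply: (saturated_corr lam_gt0 mu_gt0 n_gt2 pi_st m_ge0 m_sum m_bal f p_gt0) => s.
  by case: (_ == _); rewrite /= ?lexx ?ler01.
have dbl s : \sum_f \sum_(r | f \in legs r) (blocked s r)%:R = 2 * \sum_r (blocked s r)%:R :> R.
  rewrite (exchange_big_dep predT) //= mulr_sumr; apply: eq_bigr => r _.
  by rewrite sumr_const card_legs -[LHS]mulr_natl.
have dbl_le : mean pi (fun s => \sum_f \sum_(r | f \in legs r) (blocked s r)%:R) <= 2 * (E * N * q).
  by rewrite (eq_mean _ dbl) meanZ ler_wpM2l.
have pi_ge0 s : 0 <= pi s by exact: stationary_ge0 pi_st.
have xB : p * x B <= eps.
  have satB : mean pi (fun s => \sum_f (alt_load s f == B)%:R * saturated R f s) <= 2 * (E * N * q).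
    apply: le_trans dbl_le; apply: (mean_le pi_ge0) => s _; apply: ler_sum => f _.
    rewrite /saturated mulr_sumr; apply: ler_sum => r fr.
    rewrite /blocked; case: eqVneq => [fB|]; last by rewrite mul0r.
    rewrite mul1r ler_nat; case: eqP => //= _; rewrite lt0b; apply/negP => /forallP /(_ f).
    by rewrite fr fB ltnn.
  have := le_trans (sat_ge B) satB.
  have -> : 2 * (E * N * q) = E * (N * (2 * q)) by ring.
  rewrite ler_pM2l //.
  rewrite lerBlDr -ler_pdivlMl // => /le_trans; apply.
  by rewrite /eps le_eqVlt; apply/orP; left; apply/eqP; field; exact: lt0r_neq0.
have xS j : (j < B)%N -> x j <= eps / p + (beta * p)^-1 * x j.+1.
  move=> jB.
  (* A route with a full direct link is available or blocked, so the upward flow out of load [j] is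
     at least its saturated routes minus the blocked ones; stationarity bounds it by the downward
     flow from [j.+1]. *)
  have cut : lam / N * (E * (N * (p * x j) - 2^-1) - 2 * (E * N * q)) <=
      mu * j.+1%:R * (E * x j.+1).
    have -> : E * x j.+1 = mean pi (fun s => \sum_f (alt_load s f == j.+1)%:R).
      by rewrite /x mulrC divfK // gt_eqF.
    rewrite mean_sum mulr_sumr.
    apply: (@le_trans _ _ (\sum_(f : edge n) lam / N * mean pi (fun s =>
       \sum_(r | f \in legs r) ((alt_load s f == j) && (s (inl (ends r)) == ord_max)
         && available s r)%:R))).
      rewrite -mulr_sumr ler_wpM2l ?divr_ge0 //; first by rewrite ltW // divr_gt0.
      apply: le_trans (lerB (sat_ge j) dbl_le) _.
      rewrite -meanB -mean_sum; apply: (mean_le pi_ge0) => s _.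
      rewrite -sumrB; apply: ler_sum => f _; rewrite /saturated mulr_sumr -sumrB.
      apply: ler_sum => r fr; rewrite /blocked.
      case: (_ == j); case: (_ == ord_max); case: available => /=; lra.
    apply: ler_sum => f _; rewrite -meanZ -meanZ -subr_le0 -meanB.
    rewrite -[leRHS](stationary_gen (fun s => (j < alt_load s f)%N%:R) pi_st).
    apply: (mean_le pi_ge0) => s _.
    exact: dar_cut_gen.
  have {}cut : p * x j <= eps + mu * j.+1%:R / lam * x j.+1.
    move: cut; rewrite -ler_pdivlMl ?divr_gt0 // lerBlDr.
    rewrite -ler_pdivlMl // lerBlDr -ler_pdivlMl // => /le_trans; apply.
    rewrite /eps le_eqVlt; apply/orP; left; apply/eqP; field.
    by rewrite !lt0r_neq0.
  have x0 : 0 <= x j.+1.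
    by apply: divr_ge0 (ltW E_gt0); apply: mean_ge0 => // s; apply: sumr_ge0.
  rewrite invfM mulrAC -mulrDl ler_pdivlMr // mulrC.
  apply: le_trans cut _; rewrite lerD2l ler_wpM2r //; exact: beta_ratio.
have sumx : \sum_(j < B.+1) x j = 1.
  rewrite -mulr_suml -mean_sum.
  transitivity (mean pi (fun=> E) / E); last first.
    by rewrite mean_cst ?(stationary_sum1 pi_st) // mulfV // gt_eqF.
  congr (_ / _); apply: eq_bigr => s _; have [->|ps] := eqVneq (pi s) 0.
    by rewrite !mul0r.
  congr (_ * _); rewrite exchange_big /=.
  transitivity (\sum_(f : edge n) (1 : R)); last by rewrite sumr_const.
  apply: eq_bigr => f _.
  have /forallP /(_ f) fB := stationary_feasible pi_st ps.
  rewrite (bigD1 (inord (alt_load s f))) //= inordK // eqxx big1 ?addr0 // => j.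
  by have [->|//] := eqVneq (alt_load s f) j; rewrite inord_val eqxx.
have p_le1 : p <= 1.
  rewrite -m_sum (bigD1 ord_max) //= lerDl; apply: sumr_ge0 => y _; exact: m_ge0.
have bp_gt0 : 0 < beta * p by rewrite mulr_gt0.
have : 1 <= B.+1%:R ^+ 2 * (beta * p)^-1 ^+ B * (eps / p).
  apply: (sum1_geometric_bound (x := x)) => //.
  - by rewrite invf_ge1 // mulr_ile1 // ltW.
  - by rewrite divr_ge0 // ltW.
  - by rewrite ler_pdivlMr // mulrC.
rewrite exprVn mulrA ler_pdivlMr // mul1r mulrAC ler_pdivlMr ?exprn_gt0 // => H.
(* The exponent splits into 2 for (B + 1)^2, (B + 3) B for (beta p)^B and B + 2 for the factor p,
   each p being at least beta^(B + 2). *)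
rewrite sqrn_add2E.
rewrite exprD -ler_pdivlMl ?exprn_gt0 //.
apply: (@le_trans _ _ (p * (beta * p) ^+ B)).
  rewrite exprD exprM mulrC ler_pM ?exprn_ge0 ?(ltW beta_gt0) ?full_ge //.
  by rewrite lerXn2r ?nnegrE ?exprn_ge0 ?(ltW beta_gt0) ?(ltW bp_gt0) // exprS ler_pM2l ?full_ge.
apply: le_trans H _; rewrite ler_wpM2r //.
by rewrite -exprVn lerXn2r ?nnegrE ?ler0n ?invr_ge0 ?(ltW beta_gt0) // -[leLHS]invrK lef_pV2 ?posrE ?invr_gt0 ?ltr0n.
Qed.

End DarLowerBound.

Lemma leq_double_subn2 n : (4 <= n)%N -> (n <= 2 * (n - 2))%N.
Proof. lia. Qed.

(** * Asymptotics of the lower bound *)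

Section LowerAsymptotics.
Variable R : realType.
Local Open Scope classical_set_scope.
Local Open Scope ring_scope.

Lemma near_ln_ge (K : R) : \forall n \near \oo, K <= ln (n%:R : R).
Proof.
near=> n; rewrite -[leLHS]expRK ler_ln ?posrE ?expR_gt0 //.
  by near: n; apply: nbhs_infty_ger.
by rewrite ltr0n; near: n; apply: nbhs_infty_gt.
Unshelve. all: by end_near. Qed.

Lemma ln_le_2sqrt (x : R) : 0 < x -> ln x <= 2 * Num.sqrt x.
Proof.
move=> x0; rewrite -{1}(sqr_sqrtr (ltW x0)) lnXn ?sqrtr_gt0 // -[leLHS]mulr_natl.
by rewrite ler_wpM2l // ltW // ln_sublinear // sqrtr_gt0.
Qed.

(** By contradiction: if b < C w with w^2 = L / (D ln L), then (b + 1) / rho <= L and b + 2 <= 2 C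
    w. So minus the logarithm of the left side of the hypothesis is at most 4 C^2 L / D <= c L / 4,
    whereas the hypothesis makes it at least c L - ln 5. *)
Lemma sqrt_log_ratio_le (rho c D : R) : 0 < rho -> 0 < c -> 1 <= D ->
  exists2 C, 0 < C & exists K, forall L b, K <= L ->
    (rho / b.+1%:R) ^+ (b.+2 ^ 2) <= 5 * expR (- (c * L)) ->
    C * Num.sqrt (L / (D * ln L)) <= b%:R.
Proof.
move=> rho0 c0 D1; pose C := Num.min 1 (c / 16).
have C0 : 0 < C by rewrite lt_min ltr01 divr_gt0.
have C1 : C <= 1 by rewrite ge_min lexx.
have Cc : C <= c / 16 by rewrite ge_min lexx orbT.
have D0 : 0 < D := lt_le_trans ltr01 D1.
exists C => //.
(* The four summands ensure in turn ln L >= 1, c L >= 2 ln 5 + 1, C w >= 2 and (b + 1) / rho <=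
   L. *)
exists (expR 1 + (2 * ln 5 + 1) / c + (8 * D / C ^+ 2) ^+ 2 + (2 * C / rho) ^+ 2) => L b KL H.
have ln5 : 0 <= ln (5 : R) by apply: ln_ge0; lra.
have t1 : 0 < expR 1 :> R by exact: expR_gt0.
have t2 : 0 <= (2 * ln 5 + 1) / c by rewrite divr_ge0 ?(ltW c0) //; lra.
have t3 : 0 <= (8 * D / C ^+ 2) ^+ 2 by exact: sqr_ge0.
have t4 : 0 <= (2 * C / rho) ^+ 2 by exact: sqr_ge0.
have L0 : 0 < L by lra.
have lnL1 : 1 <= ln L.
  by rewrite -[leLHS]expRK ler_ln ?posrE //; move: KL; rewrite -!addrA; lra.
have lnL0 : 0 < ln L by exact: lt_le_trans lnL1.
have cL : 2 * ln 5 + 1 <= c * L.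
  by rewrite [c * L]mulrC -ler_pdivrMr //; lra.
pose S := Num.sqrt L.
have S0 : 0 < S by rewrite sqrtr_gt0.
have SE : S ^+ 2 = L by rewrite sqr_sqrtr // ltW.
have sqS a : 0 <= a -> a ^+ 2 <= L -> a <= S.
  by move=> a0 aL; rewrite -(@ler_pXn2r _ 2) ?nnegrE ?(ltW S0) // SE.
have S3 : 8 * D / C ^+ 2 <= S.
  by apply: sqS; [rewrite divr_ge0 ?sqr_ge0 // mulr_ge0 // ltW | lra].
have S4 : 2 * C / rho <= S.
  by apply: sqS; [rewrite divr_ge0 ?(ltW rho0) // mulr_ge0 // ltW | lra].
rewrite leNgt; apply/negP; set w := Num.sqrt _ => bC.
have q0 : 0 < L / (D * ln L) by rewrite divr_gt0 // mulr_gt0.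
have w0 : 0 < w by rewrite sqrtr_gt0.
have wE : w ^+ 2 = L / (D * ln L) by rewrite sqr_sqrtr // ltW.
have w2 : 2 <= C * w.
  rewrite -(@ler_pXn2r _ 2) ?nnegrE ?mulr_ge0 ?(ltW C0) ?(ltW w0) //.
  rewrite exprMn wE mulrC -ler_pdivrMr ?exprn_gt0 //.
  rewrite ler_pdivlMr ?mulr_gt0 //.
  apply: (@le_trans _ _ (2 ^+ 2 / C ^+ 2 * (D * (2 * S)))).
    rewrite ler_wpM2l ?divr_ge0 ?sqr_ge0 // ler_wpM2l ?(ltW D0) //.
    exact: ln_le_2sqrt.
  have -> : 2 ^+ 2 / C ^+ 2 * (D * (2 * S)) = 8 * D / C ^+ 2 * S by field; exact: lt0r_neq0.
  by rewrite -SE expr2 ler_wpM2r // ltW.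
have bw : b.+2%:R <= 2 * (C * w).
  by rewrite -addn2 natrD; lra.
have wS : w <= S.
  rewrite ler_wsqrtr // ler_pdivrMr ?mulr_gt0 // ler_peMr ?(ltW L0) //.
  by rewrite -[leLHS]mulr1 ler_pM.
have bL : b.+1%:R / rho <= L.
  rewrite ler_pdivrMr //; apply: (@le_trans _ _ (2 * (C * w))).
    by apply: le_trans bw; rewrite ler_nat.
  apply: (@le_trans _ _ (2 * C * S)); first by rewrite -mulrA !ler_wpM2l // ltW.
  have S4' : 2 * C <= S * rho by rewrite -ler_pdivrMr.
  by rewrite -SE expr2 [leRHS]mulrAC ler_wpM2r // ltW.
have r0 : 0 < rho / b.+1%:R by rewrite divr_gt0.
have : ln ((rho / b.+1%:R) ^+ (b.+2 ^ 2)) <= ln (5 * expR (- (c * L))).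
  by rewrite ler_ln ?posrE ?exprn_gt0 // mulr_gt0 // expR_gt0.
rewrite lnXn // [ln (5 * _)]lnM ?posrE ?expR_gt0 // expRK -[rho / _]invf_div lnV ?posrE ?divr_gt0 //.
rewrite -[leLHS]mulr_natr mulNr => {}H.
suff : ln (b.+1%:R / rho) * (b.+2 ^ 2)%:R <= c * L / 4 by lra.
apply: (@le_trans _ _ (ln L * (2 * (C * w)) ^+ 2)).
  apply: (@le_trans _ _ (ln L * (b.+2 ^ 2)%:R)).
    by rewrite ler_wpM2r // ler_ln ?posrE ?divr_gt0.
  rewrite ler_wpM2l ?(ltW lnL0) // natrX lerXn2r ?nnegrE // mulr_ge0 // mulr_ge0 // ltW //.
rewrite !exprMn wE.
have -> : ln L * (2 ^+ 2 * (C ^+ 2 * (L / (D * ln L)))) = 4 * C ^+ 2 * L / D.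
  by field; rewrite !gt_eqF.
rewrite ler_pdivrMr //; apply: (@le_trans _ _ (c * L / 4 * 1)); last first.
  by rewrite ler_wpM2l // divr_ge0 // mulr_ge0 // ltW.
rewrite mulr1 [leRHS]mulrAC ler_wpM2r ?(ltW L0) //.
have : C ^+ 2 <= C * 1 by rewrite expr2 ler_wpM2l // ltW.
lra.
Qed.

Lemma dar_necessary (lam mu : R) (d : nat) (B : nat -> nat) :
  0 < lam -> 0 < mu -> (0 < d)%N ->
  not_lost_whp lam mu (fun n => @dar n (B n) d) ->
  exists2 C : R, 0 < C & \forall n \near \oo,
    C * Num.sqrt (ln n%:R / (d%:R * ln (ln n%:R))) <= (B n)%:R.
Proof.
case: d => // d lam0 mu0 _ [pi [pi_st [c c0 loss]]].
set D : R := d.+1%:R; have D0 : 0 < D by rewrite ltr0n.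
(* The minimum with 1 lets exp(- c1 ln n) also dominate the term 1 / (2 (n - 2)). *)
pose c1 := Num.min 1 (c / D).
have c10 : 0 < c1 by rewrite lt_min ltr01 divr_gt0.
have rho0 : 0 < Num.min 1 (lam / mu) by rewrite lt_min ltr01 divr_gt0.
have D1 : 1 <= D by rewrite ler1n.
have [C C0 [K HK]] := sqrt_log_ratio_le rho0 c10 D1.
exists C => //; near=> n.
have n4 : (4 <= n)%N by near: n; apply: nbhs_infty_ge.
have n0 : 0 < n%:R :> R by rewrite ltr0n (leq_trans _ n4).
apply: HK; first by near: n; apply: near_ln_ge.
have [st _] := pi_st n.
have [m [m0 sm bm]] := balanced_exists (@bd_rate_ge0 R lam mu lam0 mu0 (B n)) ord0.
set L := ln n%:R.
have L0 : 0 <= L by apply: ln_ge0; rewrite ler1n (leq_trans _ n4).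
(* Chosen so that tau^D = n^(-c) bounds the loss; then loss / tau^d <= tau, and the three error
   terms add up to at most 5 exp(- c1 ln n). *)
pose tau := expR (- (c / D * L)).
have tau0 : 0 < tau by exact: expR_gt0.
have n2 : (2 < n)%N by exact: leq_trans n4.
apply: le_trans (dar_core lam0 mu0 n2 st m0 sm bm tau0) _.
have taule : tau <= expR (- (c1 * L)).
  by rewrite ler_expR lerN2 ler_wpM2r // ge_min lexx orbT.
have lossle : loss_prob (@dar n (B n) d.+1) (pi n) / tau ^+ d <= tau.
  rewrite ler_pdivrMr ?exprn_gt0 // -exprS.
  have -> : tau ^+ d.+1 = 1 / n%:R `^ c.
    rewrite -expRM_natr /powR gt_eqF // div1r -expRN mulNr; congr expR; congr (- _).
    by rewrite mulrAC -/D divfK // gt_eqF.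
  by rewrite -lerN2 -(lerD2l 1); near: n.
have N1 : (2 * (n - 2)%:R)^-1 <= expR (- (c1 * L)).
  apply: (@le_trans _ _ n%:R^-1).
    rewrite lef_pV2 ?posrE ?mulr_gt0 ?n0 ?ltr0n ?subn_gt0 //.
    by rewrite -natrM ler_nat leq_double_subn2.
  rewrite -ler_ln ?posrE ?invr_gt0 ?expR_gt0 // expRK lnV ?posrE // lerN2 -/L ler_piMl //.
  by rewrite ge_min lexx.
lra.
Unshelve. all: by end_near. Qed.

End LowerAsymptotics.

(** * Balanced routing *)

Section Loads.
Local Open Scope nat_scope.
Variables n B d : nat.
Implicit Types (s t : state n B) (e f : edge n) (r : route n) (u v : 'I_n).

(* Everything is counted at a vertex u: [degree] is the number of incident edges of
   load at least k, and [excess k] dominates [degree k.+1]. *)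
Definition degree k s u := \sum_(f : edge n | u \in val f) (k <= alt_load s f).
Definition excess k s u := \sum_(f : edge n | u \in val f) (alt_load s f - k).

Lemma degree_le_excess k s u : degree k.+1 s u <= excess k s u.
Proof. by apply: leq_sum => f _; case: leqP => //; rewrite subn_gt0. Qed.

Lemma mul_degree_le k s u : k * degree k s u <= excess 0 s u.
Proof.
rewrite /degree big_distrr /=; apply: leq_sum => f _.
by rewrite subn0; case: (leqP k (alt_load s f)); rewrite ?muln1 ?muln0.
Qed.

Lemma degree_le k s u : degree k s u <= n.
Proof.
apply: leq_trans (card_star u); rewrite -sum1dep_card; apply: leq_sum => f _.
exact: leq_b1.
Qed.

Lemma route_load_ge k s r : k <= route_load s r ->
  exists2 f, f \in legs r & k <= alt_load s f.
Proof.
have legs0 : 0 < #|legs r| by rewrite card_legs.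
move=> kr; have [f fr fE] := eq_bigmax_cond (alt_load s) legs0.
  by exists f => //; rewrite -fE.
Qed.

Lemma leq_route_load s r f : f \in legs r -> alt_load s f <= route_load s r.
Proof. by move=> fr; apply: (leq_bigmax_cond _ fr). Qed.

Definition heavy k s e : {set route n} := [set r | (ends r == e) && (k <= route_load s r)]%SET.

(** A heavy route has a leg of load at least [k], which contains an end of [e], and that leg
    determines the route. *)
Lemma card_heavy k s e : #|heavy k s e| <= \sum_(u in val e) degree k s u.
Proof.
apply: (@leq_trans (\sum_(r in heavy k s e) \sum_(f : edge n | k <= alt_load s f) (f \in legs r))).
  rewrite -sum1_card; apply: leq_sum => r; rewrite inE => /andP[_ /route_load_ge[f fr kf]].
  by rewrite (bigD1 f) //= fr leq_addr.
rewrite exchange_big /=.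
rewrite /degree [leqRHS](exchange_big_dep predT) //= [leqLHS]big_mkcond /=; apply: leq_sum => f _.
case: ifP => // kf; rewrite sum_nat_const muln1.
have [/existsP[u /andP[ue uf]]|] := boolP [exists u in val e, u \in val f].
  apply: (@leq_trans 1); last by apply/card_gt0P; exists u; rewrite unfold_in; apply/andP.
  rewrite -big_mkcondr /= sum1_card; apply/card_le1_eqP => r r' /andP[+ fr] /andP[+ fr'].
  rewrite !inE => /andP[/eqP re _] /andP[/eqP re' _].
  by apply: (legs_ends_inj fr' fr); rewrite re.
rewrite negb_exists => /forallP meet; rewrite big1 // => r; rewrite inE => /andP[/eqP re _].
apply/eqP; rewrite eqb0; apply/negP => /legs_meet[u uf]; rewrite re => ue.
by have := meet u; rewrite ue uf.
Qed.

Lemma card_touch k s u :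
  #|[set r | [exists f in legs r, (u \in val f) && (k <= alt_load s f)]]%SET|
  <= 2 * (n - 2) * degree k s u.
Proof.
rewrite -sum1_card /degree big_distrr /=.
apply: (@leq_trans (\sum_(r : route n) \sum_(f : edge n | u \in val f)
   (f \in legs r) * (k <= alt_load s f))).
  rewrite big_mkcond; apply: leq_sum => r _; rewrite inE; case: existsP => // -[f].
  by move=> /and3P[fr uf kf]; rewrite (bigD1 f) //= fr kf leq_addr.
rewrite exchange_big /=; apply: leq_sum => f _.
by rewrite -big_distrl /= -(card_users f) leq_mul2r -big_mkcond sum1dep_card leqnn orbT.
Qed.

End Loads.

Lemma leq_sum2_term (I J : finType) (P : pred J) i j (F : I -> J -> nat) :
  P j -> (F i j <= \sum_i \sum_(j | P j) F i j)%N.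
Proof. by move=> Pj; rewrite (bigD1 i) //= (bigD1 j) //= -addnA leq_addr. Qed.

Section BalancedRouting.
Local Open Scope nat_scope.
Variables n B d : nat.
Hypotheses (n_gt2 : (2 < n)%N) (d_gt1 : (1 < d)%N).
Variable pick : selection n B d.
Hypothesis pick_min : min_load_rule pick.
Implicit Types (s t : state n B) (e f : edge n) (r : route n) (u v : 'I_n).

Let next := next_state (bdar pick).

Lemma nextE s e c : next s e c =
  if available s (tnth c (pick s e c)) then add_call (inr (tnth c (pick s e c))) s else s.
Proof. by rewrite /next /next_state /bdar; case: ifP. Qed.

(** Both legs are incident to [u] when [u] is the midpoint; this is why jumps of size two have to be
    handled below. *)
Lemma excess_add_le k s r u : available s r ->
  (excess k (add_call (inr r) s) u <= (excess k s u).+2)%N.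
Proof.
move=> av; rewrite /excess.
apply: (@leq_trans (\sum_(f : edge n | u \in val f) (alt_load s f - k + (f \in legs r)))).
  apply: leq_sum => f _; rewrite alt_load_addr ?available_lt //.
  by rewrite leq_subLR addnA leq_add2r -leq_subLR.
rewrite big_split -[leqRHS]addn2 leq_add2l.
apply: (@leq_trans #|legs r|); last by rewrite card_legs.
rewrite -sum1_card big_mkcond [leqRHS]big_mkcond /=.
by apply: leq_sum => f _; case: ifP => // _; case: ifP.
Qed.

Lemma excess_next_le k s e c u : (excess k (next s e c) u <= (excess k s u).+2)%N.
Proof.
by rewrite nextE; case: ifP => [av|_]; [exact: excess_add_le | rewrite -addn2 leq_addr].
Qed.

Definition touch k s u : {set route n} :=
  [set r | [exists f in legs r, (u \in val f) && (k <= alt_load s f)%N]]%SET.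

Lemma excess_lt_next k s e c u : (excess k s u < excess k (next s e c) u)%N ->
  tnth c (pick s e c) \in touch k s u.
Proof.
rewrite nextE; case: ifP => [av|]; last by rewrite ltnn.
set r := tnth c _ in av *; apply: contraLR; rewrite inE negb_exists => /forallP nt.
rewrite -leqNgt; apply: leq_sum => f uf; rewrite alt_load_addr ?available_lt //.
have := nt f; rewrite uf /=; case: (f \in legs r) => /=; last by rewrite addn0.
by rewrite -ltnNge => Xk; rewrite addn1 (eqP (_ : (alt_load s f).+1 - k == 0)%N) ?leq0n // subn_eq0.
Qed.

Definition raised k s e u : {set d.-tuple (route n)} :=
  [set c in choices d e | (excess k s u < excess k (next s e c) u)%N]%SET.

Lemma touch_heavy k s e r u : r \in touch k s u -> ends r = e -> r \in heavy k s e.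
Proof.
rewrite !inE => /existsP[f /and3P[fr _ kf]] ->; rewrite eqxx /=.
exact: leq_trans kf (leq_route_load _ fr).
Qed.

(** The selected route must touch a loaded edge at [u]. Having minimum load, it forces the other d -
    1 draws to be heavy; the factor [d] is the position of the selected draw. *)
Lemma card_raised k s e u :
  (#|raised k s e u| <= d * #|[set r in touch k s u | ends r == e]%SET| * #|heavy k s e| ^ d.-1)%N.
Proof.
pose F j r := [set c in choices d e | (tnth c j == r) && [forall i, tnth c i \in heavy k s e]]%SET.
have sub : heavy k s e \subset [set r | ends r == e]%SET.
  by apply/fintype.subsetP => r; rewrite !inE => /andP[].
apply: (@leq_trans (\sum_(j < d) \sum_(r in [set r in touch k s u | ends r == e]%SET) #|F j r|)).
  rewrite -sum1_card.
  under [leqRHS]eq_bigr => j _ do under eq_bigr => r _ do rewrite -sum1_card big_mkcond /=.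
  under [leqRHS]eq_bigr => j _ do rewrite exchange_big /=.
  rewrite exchange_big [leqLHS]big_mkcond /=; apply: leq_sum => c _.
  case: ifP => //; rewrite finset.in_set => /andP[cc inc].
  have ct := excess_lt_next inc.
  have ce i : ends (tnth c i) = e.
    by move: cc; rewrite choicesE => /forallP /(_ i); rewrite inE => /eqP.
  have ch i : tnth c i \in heavy k s e.
    rewrite inE ce eqxx /=; apply: leq_trans (pick_min s e c i).
    by have := touch_heavy ct (ce _); rewrite inE => /andP[].
  have cF : c \in F (pick s e c) (tnth c (pick s e c)).
    by rewrite finset.in_set cc eqxx /=; apply/forallP.
  have ct' : tnth c (pick s e c) \in [set r in touch k s u | ends r == e]%SET.
    by rewrite finset.in_set ct ce eqxx.
  have := @leq_sum2_term _ _ _ (pick s e c) _ (fun j r => if c \in F j r then 1 else 0) ct'.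
  by rewrite cF.
set X := #|[set r in touch k s u | ends r == e]%SET|.
have -> : d * X * #|heavy k s e| ^ d.-1 = \sum_(j < d) (X * #|heavy k s e| ^ d.-1).
  by rewrite sum_nat_const card_ord mulnA.
apply: leq_sum => j _.
rewrite -sum_nat_const; apply: leq_sum => r; rewrite finset.in_set => /andP[rt /eqP re].
by rewrite card_choices_nth // (touch_heavy rt).
Qed.

(** Each pair has at most 2b heavy routes, and at most 2 (n - 2) b routes in all touch a loaded edge
    at [u]. Relative to the (n - 2)^d draws this is of order n (b / n)^d. *)
Lemma sum_card_raised k s u b : (forall v, (degree k s v <= b)%N) ->
  (\sum_e #|raised k s e u| <= d * (2 * b) ^ d.-1 * (2 * (n - 2) * b))%N.
Proof.
move=> degb; have hb e : (#|heavy k s e| <= 2 * b)%N.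
  apply: leq_trans (card_heavy _ _ _) _; 
  apply: (@leq_trans (\sum_(u in val e) b)); first by apply: leq_sum.
  by rewrite sum_nat_const card_val_edge.
apply: (@leq_trans (\sum_e d * (2 * b) ^ d.-1 * #|[set r in touch k s u | ends r == e]%SET|)).
  apply: leq_sum => e _; apply: leq_trans (card_raised _ _ _ _) _.
  by rewrite mulnAC leq_mul2r leq_mul2l leq_exp2r ?hb ?orbT // -subn1 subn_gt0.
rewrite -big_distrr leq_mul2l; apply/orP; right.
apply: (@leq_trans #|touch k s u|); last first.
  by apply: leq_trans (card_touch _ _ _) _; rewrite leq_mul2l degb orbT.
rewrite -[leqRHS]sum1_card (partition_big (@ends n) predT) //=.
apply: leq_sum => e _; rewrite -sum1_card; apply: eq_leq.
by apply: eq_bigl => r; rewrite finset.in_set.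
Qed.

End BalancedRouting.

(** * Effect of departures on the excess *)

Section Departures.
Local Open Scope nat_scope.
Variables n B : nat.
Implicit Types (s : state n B) (f : edge n) (r : route n) (u : 'I_n).

Lemma excess_del_le k s p u : excess k (del_call p s) u <= excess k s u.
Proof. by apply: leq_sum => f _; rewrite leq_sub2r ?alt_load_del_le. Qed.

Lemma excess_del_lt k s r f u : 0 < s (inr r) -> f \in legs r -> u \in val f ->
  k < alt_load s f -> excess k (del_call (inr r) s) u < excess k s u.
Proof.
move=> s0 fr uf kf; rewrite /excess (bigD1 f uf) [X in _ < X](bigD1 f uf) /=.
rewrite -addSn leq_add //; last first.
  by apply: leq_sum => g _; rewrite leq_sub2r ?alt_load_del_le.
by move: kf; rewrite -(alt_load_delr f s0) fr addn1 ltnS => kf; rewrite subSn.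
Qed.

(** Any call on an edge at [u] of load above [k] lowers the excess when it ends, and a call lies on
    at most two such edges. *)
Lemma excess_le_departures k s u :
  excess k s u <= 2 * \sum_r s (inr r) * (excess k (del_call (inr r) s) u < excess k s u).
Proof.
apply: (@leq_trans (\sum_(f : edge n | u \in val f) \sum_(r | f \in legs r)
    s (inr r) * (k < alt_load s f))).
  apply: leq_sum => f _; rewrite -big_distrl /=.
  by case: ltnP => [_|Xk]; rewrite ?muln1 ?leq_subr // muln0 leqn0 subn_eq0.
rewrite (exchange_big_dep predT) //= big_distrr /=; apply: leq_sum => r _.
have [->|s0] := posnP (s (inr r)); first by rewrite big1.
rewrite -big_distrr /= mulnCA leq_mul2l; apply/orP; right.
case: (ltnP (excess k _ u)) => [_|ge].
  rewrite muln1; apply: (@leq_trans #|legs r|); last by rewrite card_legs.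
  rewrite -sum1_card big_mkcond [leqRHS]big_mkcond /=.
  by apply: leq_sum => f _; case: (f \in legs r); rewrite ?andbF // andbT; case: ifP => // _; apply: leq_b1.
rewrite muln0 leqn0; apply/eqP/big1 => f /andP[uf fr]; apply/eqP; rewrite eqb0.
by apply: contraL ge => kf; rewrite -ltnNge (excess_del_lt s0 fr).
Qed.

Lemma excess_feasible k s u : feasible s -> excess k s u <= n * B.
Proof.
move=> /forallP sB; apply: (@leq_trans (#|[set f : edge n | u \in val f]%SET| * B)).
  rewrite -sum1dep_card big_distrl /=; apply: leq_sum => f _.
  by rewrite mul1n; apply: leq_trans (sB f); apply: leq_subr.
by rewrite leq_mul2r card_star orbT.
Qed.

End Departures.

(** * Flow of the excess across a level *)

Section Balanced.
Variables (R : realType) (lam mu : R).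
Hypotheses (lam_gt0 : 0 < lam) (mu_gt0 : 0 < mu).
Variables n B d : nat.
Hypotheses (n_gt2 : (2 < n)%N) (d_gt1 : (1 < d)%N).
Variable pick : selection n B d.
Hypothesis pick_min : min_load_rule pick.
Variable pi : law R n B.
Hypothesis pi_st : stationary lam mu (bdar pick) pi.
Implicit Types (s t : state n B) (e f : edge n) (r : route n) (u v : 'I_n).

Let pi_ge0 s : 0 <= pi s.
Proof. exact: stationary_ge0 pi_st. Qed.

Let pi_sum : \sum_s pi s = 1.
Proof. exact: stationary_sum1 pi_st. Qed.

Definition rise_rate k s u : R :=
  lam / ((n - 2) ^ d)%:R * (\sum_e #|raised pick k s e u|)%:R.

Lemma in_raised k s e u c : (c \in raised pick k s e u) =
  (c \in choices d e) && (excess k s u < excess k (next_state (bdar pick) s e c) u)%N.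
Proof. exact: finset.in_set. Qed.

(** A call raises the excess by at most two, so level [m] is crossed upwards only from m or m - 1.
    From m + 1, every departure that lowers the excess crosses downwards, at total rate at least mu
    (m + 1) / 2. *)
Lemma bdar_cut_gen k u m s :
  gen lam mu (bdar pick) (fun s => (m < excess k s u)%N%:R) s <=
  ((excess k s u == m) + ((excess k s u).+1 == m))%:R * rise_rate k s u
  - mu / 2 * m.+1%:R * (excess k s u == m.+1)%:R.
Proof.
rewrite /gen; set W := excess k s u; apply: lerD.
  rewrite /rise_rate natr_sum mulrA mulr_sumr; apply: ler_sum => e _.
  rewrite -[#|raised pick k s e u|]sum1_card natr_sum mulr_sumr (big_mkcond (fun c => c \in raised _ _ _ _ _)) /= [leLHS]big_mkcond /=.
  apply: ler_sum => c _; rewrite in_raised; case: (c \in choices d e) => //=.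
  rewrite card_choices -/W; set W' := excess k _ u; rewrite -/W'.
  have W'le : (W' <= W.+2)%N by exact: excess_next_le.
  have a0 : 0 <= lam / ((n - 2) ^ d)%:R by rewrite divr_ge0 // ltW.
  case: (ltnP W W') => WW'; last first.
    rewrite mulr_ge0_le0 // subr_le0 ler_nat.
    by case: (ltnP m W') => // mW'; rewrite (leq_trans mW' WW').
  rewrite mulr1 mulrC ler_wpM2r //.
  apply: (@le_trans _ _ ((m < W')%N%:R - (m < W)%N%:R)) => //.
  rewrite lerBlDr -natrD ler_nat.
  case: (ltnP m W') => // mW'; case: (ltnP m W) => mW; first by rewrite addn1.
  by rewrite addn0 lt0n addn_eq0 !eqb0; lia.
rewrite big_sumType /= big1 ?add0r => [|e _]; last first.
  have -> : excess k (del_call (inl e) s) u = W.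
    by apply: eq_bigr => f _; rewrite alt_load_dell.
  by rewrite subrr mulr0.
have [Wm|Wm] := eqVneq W m.+1; last first.
  rewrite mulr0 oppr0; apply: sumr_le0 => r _; rewrite mulr_ge0_le0 ?mulrn_wge0 ?(ltW mu_gt0) //.
  rewrite subr_le0 ler_nat; have := excess_del_le k s (inr r) u; rewrite -/W.
  set W' := excess _ _ _ => W'W; case: (ltnP m W') => // mW'.
  by rewrite (leq_trans mW' W'W).
have mW : (m < W)%N by rewrite Wm.
rewrite mW mulr1 -Wm.
apply: (@le_trans _ _
  (- (mu * (\sum_r s (inr r) * (excess k (del_call (inr r) s) u < W)%N)%N%:R))).
  rewrite natr_sum mulr_sumr -sumrN; apply: ler_sum => r _.
  set b := (_ < W)%N.
  have -> : - (mu * (s (inr r) * b)%N%:R) = (mu *+ s (inr r)) * - b%:R.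
    by rewrite natrM -[mu *+ _]mulr_natr mulrN mulrA.
  rewrite ler_wpM2l ?mulrn_wge0 ?(ltW mu_gt0) // /b Wm ltnS.
  by case: ltnP => _; rewrite ?subrr ?oppr0 // sub0r.
rewrite lerN2 -mulrA ler_wpM2l ?(ltW mu_gt0) // ler_pdivrMl //.
by rewrite -natrM ler_nat excess_le_departures.
Qed.

End Balanced.

(** Induction on two consecutive terms. The ratio 3/4 works because (3/4 + 1) / 4 <= (3/4)^2, and
    the error 2 eta reproduces itself. *)
Lemma two_step_geometric (R : realFieldType) (z : nat -> R) (eta : R) m0 :
  0 <= eta -> (forall m, z m <= 1) ->
  (forall m, (m0 <= m)%N -> z m.+2 <= (z m.+1 + z m) / 4 + eta) ->
  forall j, z (m0 + j)%N <= 2 * (3 / 4) ^+ j + 2 * eta.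
Proof.
move=> eta0 z1 zS j; suff [] : z (m0 + j)%N <= 2 * (3 / 4) ^+ j + 2 * eta /\
  z (m0 + j.+1)%N <= 2 * (3 / 4) ^+ j.+1 + 2 * eta by [].
elim: j => [|j [IH0 IH1]].
  rewrite expr0 expr1; have := z1 (m0 + 0)%N; have := z1 (m0 + 1)%N.
  by split; lra.
split=> //; rewrite !addnS in IH1 *.
apply: le_trans (zS _ (leq_addr _ _)) _.
have x0 : 0 <= (3 / 4) ^+ j :> R by rewrite exprn_ge0.
move: IH0 IH1 x0; rewrite !exprS; set x := _ ^+ j; lra.
Qed.

(** * Geometric tail of the excess *)

Section BalancedTail.
Variables (R : realType) (lam mu : R).
Hypotheses (lam_gt0 : 0 < lam) (mu_gt0 : 0 < mu).
Variables n B d : nat.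
Hypotheses (n_gt2 : (2 < n)%N) (d_gt1 : (1 < d)%N).
Variable pick : selection n B d.
Hypothesis pick_min : min_load_rule pick.
Variable pi : law R n B.
Hypothesis pi_st : stationary lam mu (bdar pick) pi.
Implicit Types (s t : state n B) (e f : edge n) (r : route n) (u v : 'I_n).

Let pi_ge0 s : 0 <= pi s.
Proof. exact: stationary_ge0 pi_st. Qed.

Let pi_sum : \sum_s pi s = 1.
Proof. exact: stationary_sum1 pi_st. Qed.

Let N_gt0 : 0 < ((n - 2) ^ d)%:R :> R.
Proof. by rewrite ltr0n expn_gt0 subn_gt0 n_gt2. Qed.

Definition crowded k b s := ~~ [forall v, degree k s v <= b]%N.

Lemma rise_rate_le k b s u : ~~ crowded k b s ->
  rise_rate lam pick k s u <= lam / ((n - 2) ^ d)%:R * (d * (2 * b) ^ d.-1 * (2 * (n - 2) * b))%:R.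
Proof.
rewrite negbK => /forallP good; rewrite ler_wpM2l ?divr_ge0 ?(ltW lam_gt0) // ler_nat.
exact: sum_card_raised.
Qed.

Lemma rise_rate_le_total k s u : rise_rate lam pick k s u <= lam * (n * n)%:R.
Proof.
rewrite /rise_rate -mulrA ler_wpM2l ?(ltW lam_gt0) // mulrC ler_pdivrMr // -natrM ler_nat.
apply: (@leq_trans (\sum_(e : edge n) (n - 2) ^ d)%N); last first.
  by rewrite sum_nat_const leq_mul2r card_edge_le orbT.
apply: leq_sum => e _; rewrite -(card_choices d e); apply/subset_leq_card/fintype.subsetP => c.
by rewrite in_raised => /andP[].
Qed.

Lemma rise_rate_ge0 k s u : 0 <= rise_rate lam pick k s u.
Proof. by rewrite mulr_ge0 // divr_ge0 // ltW. Qed.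

(* Balance of the probability flow through {excess > m + 1}; a call changes the excess
   by at most two, which is why the two levels below enter on the right. *)
Lemma excess_cut k u b m (a := lam / ((n - 2) ^ d)%:R * (d * (2 * b) ^ d.-1 * (2 * (n - 2) * b))%:R) :
  mu / 2 * m.+2%:R * mean pi (fun s => (excess k s u == m.+2)%:R) <=
  a * (mean pi (fun s => (excess k s u == m.+1)%:R) + mean pi (fun s => (excess k s u == m)%:R))
  + lam * (n * n)%:R * mean pi (fun s => (crowded k b s)%:R).
Proof.
have a0 : 0 <= a by rewrite mulr_ge0 // divr_ge0 // ltW.
rewrite -meanD -!meanZ -meanD -subr_ge0 -meanB.
rewrite -[leLHS](stationary_gen (fun s => (m.+1 < excess k s u)%N%:R) pi_st).
apply: (mean_le pi_ge0) => s _; apply: le_trans (bdar_cut_gen lam_gt0 mu_gt0 n_gt2 d_gt1 pick k u m.+1 s) _.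
rewrite lerD2r eqSS natrD; set x : R := _%:R + _%:R.
have x0 : 0 <= x by rewrite addr_ge0.
have x1 : x <= 1.
  rewrite /x; case: eqVneq => [->|_]; last by rewrite add0r lern1 leq_b1.
  by rewrite gtn_eqF ?addr0 // .
have [cr|cr] := boolP (crowded k b s).
  rewrite mulr1 -[leLHS]add0r; apply: lerD; first exact: mulr_ge0.
  apply: le_trans (rise_rate_le_total k s u); rewrite ler_piMl //; exact: rise_rate_ge0.
rewrite mulr0 addr0 mulrC ler_wpM2r //; exact: rise_rate_le.
Qed.

(** Beyond [m0] the downward rate mu (m + 2) / 2 is at least four times the rise rate, so point
    probabilities decay geometrically up to the crowding error, and [m0] further steps give
    (3/4)^m0. A union bound covers the [n] vertices and the values of the excess, which is at most n
    B. *)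
Lemma level_step k b m0 :
  8 * (lam / ((n - 2) ^ d)%:R * (d * (2 * b) ^ d.-1 * (2 * (n - 2) * b))%:R) <= mu * m0%:R ->
  mean pi (fun s => (~~ [forall u, excess k s u <= 2 * m0]%N)%:R) <=
  (n * (n * B).+1)%:R * (2 * (3 / 4) ^+ m0
    + 2 * (lam * (n * n)%:R / mu * mean pi (fun s => (crowded k b s)%:R))).
Proof.
set a := lam / _ * _ => am0.
set delta := mean pi (fun s => (crowded k b s)%:R).
have d0 : 0 <= delta by apply: mean_ge0.
set eta := lam * (n * n)%:R / mu * delta.
have eta0 : 0 <= eta by rewrite mulr_ge0 // divr_ge0 ?(ltW mu_gt0) // mulr_ge0 // ltW.
pose z u m := mean pi (fun s => (excess k s u == m)%:R).
have z0 u m : 0 <= z u m by apply: mean_ge0.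
have z1 u m : z u m <= 1.
  rewrite -[leRHS](mean_cst pi_sum); apply: (mean_le pi_ge0) => s _.
  by rewrite lern1 leq_b1.
have rec u m : (m0 <= m)%N -> z u m.+2 <= (z u m.+1 + z u m) / 4 + eta.
  move=> m0m; have D0 : 0 < mu / 2 * m.+2%:R by rewrite mulr_gt0 // divr_gt0.
  apply: (@le_trans _ _ ((a * (z u m.+1 + z u m) + lam * (n * n)%:R * delta) / (mu / 2 * m.+2%:R))).
    by rewrite ler_pdivlMr // mulrC; apply: excess_cut.
  rewrite mulrDl; apply: lerD.
    rewrite ler_pdivrMr // [leLHS]mulrC -[leRHS]mulrA; apply: ler_wpM2l; first by rewrite addr_ge0.
    have : mu * m0%:R <= mu * m.+2%:R.
      by rewrite ler_wpM2l ?(ltW mu_gt0) // ler_nat (leq_trans m0m) // -addn2 leq_addr.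
    move: am0; lra.
  rewrite /eta ler_pdivrMr //; set Lam := lam * _.
  have -> : Lam / mu * delta * (mu / 2 * m.+2%:R) = Lam * delta * (m.+2%:R / 2).
    by field; exact: lt0r_neq0.
  rewrite ler_peMr ?mulr_ge0 ?(ltW lam_gt0) //.
  by rewrite ler_pdivlMr // mul1r ler_nat.
have tail u j : z u (m0 + j)%N <= 2 * (3 / 4) ^+ j + 2 * eta.
  exact: (two_step_geometric eta0 (z1 u) (rec u)).
have tail_sum u : mean pi (fun s => (2 * m0 < excess k s u)%N%:R) <=
    (n * B).+1%:R * (2 * (3 / 4) ^+ m0 + 2 * eta).
  apply: (@le_trans _ _ (mean pi (fun s => \sum_(m < (n * B).+1 | (2 * m0 < m)%N) (excess k s u == m)%:R))).
    apply: (mean_le pi_ge0) => s /(stationary_feasible pi_st) fs.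
    case: ltnP => [lt|_]; last by apply: sumr_ge0.
    have le : (excess k s u < (n * B).+1)%N by rewrite ltnS excess_feasible.
    by rewrite (bigD1 (Ordinal le)) //= eqxx lerDl; apply: sumr_ge0.
  rewrite mean_sum mulr_natl -[in leRHS](card_ord (n * B).+1) -sumr_const.
  rewrite big_mkcond; apply: ler_sum => m _; case: ifP => [lt|_]; last first.
    by have : 0 <= (3 / 4) ^+ m0 :> R; [rewrite exprn_ge0 // divr_ge0 | move: eta0; lra].
  have := tail u (m - m0)%N; rewrite subnKC; last by rewrite ltnW //; apply: leq_ltn_trans lt; rewrite leq_pmull.
  move/le_trans; apply; rewrite lerD2r ler_wpM2l // ler_wiXn2l ?divr_ge0 //.
    by rewrite ler_pdivrMr // mul1r ler_nat.
  by rewrite leq_subRL ?addnn -?mul2n; apply: ltnW => //; apply: leq_ltn_trans lt; rewrite leq_pmull.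
apply: (@le_trans _ _ (mean pi (fun s => \sum_u (2 * m0 < excess k s u)%N%:R))).
  apply: (mean_le pi_ge0) => s _; case: forallP => [_|]; first by apply: sumr_ge0.
  move/forallP; rewrite negb_forall => /existsP[u]; rewrite -ltnNge => lt.
  by rewrite (bigD1 u) //= lt lerDl; apply: sumr_ge0.
rewrite mean_sum natrM -mulrA; set X := _ * (_ + _).
have -> : n%:R * X = \sum_(u < n) X by rewrite sumr_const card_ord mulr_natl.
by apply: ler_sum => u _; exact: tail_sum.
Qed.

End BalancedTail.

(** * Rejections under BDAR* *)

Section BalancedLoss.
Variables (R : realType) (lam mu : R).
Hypotheses (lam_gt0 : 0 < lam) (mu_gt0 : 0 < mu).
Variables n B d : nat.
Variable pick : selection n B d.
Hypothesis pick_min : min_load_rule pick.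
Implicit Types (s t : state n B) (e f : edge n) (r : route n) (u v : 'I_n).

Lemma bdar_stationary_exists : exists pi : law R n B, unique (stationary lam mu (bdar pick)) pi.
Proof.
apply: stationary_exists => // s e c p /forallP fs; rewrite /bdar.
case: ifP => // /[dup] av /forallP av' [<-]; apply/forallP => f.
rewrite alt_load_addr ?available_lt //; have := av' f.
by case: (f \in legs _) => /= [|_]; rewrite ?addn1 ?addn0.
Qed.

Hypothesis n_gt2 : (2 < n)%N.
Variable pi : law R n B.
Hypothesis pi_st : stationary lam mu (bdar pick) pi.

Let pi_ge0 s : 0 <= pi s.
Proof. exact: stationary_ge0 pi_st. Qed.

Let pi_sum : \sum_s pi s = 1.
Proof. exact: stationary_sum1 pi_st. Qed.

Lemma card_rejected s e :
  (#|[set c in choices d e | bdar pick s e c == None]%SET| <= #|heavy B s e| ^ d)%N.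
Proof.
have sub : heavy B s e \subset [set r | ends r == e]%SET.
  by apply/fintype.subsetP => r; rewrite !inE => /andP[].
rewrite -(card_choices_sub d sub); apply/subset_leq_card/fintype.subsetP => c.
move=> /finset.setIdP[ce]; rewrite /bdar; case: ifP => // /negbT.
rewrite negb_forall => /existsP[f]; rewrite negb_imply -leqNgt.
move=> /andP[fr Bf] _; apply/finset.setIdP; split=> //; apply/forallP => i; rewrite inE.
move: ce; rewrite choicesE => /forallP /(_ i); rewrite inE => -> /=.
apply: leq_trans (pick_min s e c i).
exact: leq_trans Bf (leq_route_load _ fr).
Qed.

Lemma bdar_loss_le b :
  loss_prob (bdar pick) pi <=
  ((2 * b)%:R / (n - 2)%:R) ^+ d + mean pi (fun s => (crowded B b s)%:R).
Proof.
set y : R := _ ^+ d; have y0 : 0 <= y by rewrite exprn_ge0 // divr_ge0.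
rewrite -(mean_cst pi_sum y) -meanD; apply: (mean_le pi_ge0) => s _.
have [E0|E0] := posnP #|edge n|.
  by rewrite E0 invr0 mulr0 addr_ge0.
rewrite ler_pdivrMr ?ltr0n // mulr_natr -sumr_const; apply: ler_sum => e _.
have N_gt0 : 0 < ((n - 2) ^ d)%:R :> R by rewrite ltr0n expn_gt0 subn_gt0 n_gt2.
rewrite card_choices ler_pdivrMr //.
have [cr|] := boolP (crowded B b s).
  apply: (@le_trans _ _ (1 * ((n - 2) ^ d)%:R)); last by rewrite ler_wpM2r // lerDr.
  rewrite mul1r ler_nat -(card_choices d e); apply/subset_leq_card/fintype.subsetP => c.
  by case/finset.setIdP.
rewrite negbK => /forallP good; rewrite addr0 /y expr_div_n natrX divfK; last first.
  by rewrite -natrX gt_eqF.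
rewrite -natrX ler_nat; apply: leq_trans (card_rejected _ _) _.
have hb : (#|heavy B s e| <= 2 * b)%N.
  apply: leq_trans (card_heavy _ _ _) _.
  apply: (@leq_trans (\sum_(u in val e) b)%N); first by apply: leq_sum.
  by rewrite sum_nat_const card_val_edge.
by case: (d) => // d'; rewrite leq_exp2r.
Qed.

End BalancedLoss.

(** * Constants of the recursion over load levels *)

Section Levels.
Variables (R : realType) (lam mu : R).
Hypotheses (lam_gt0 : 0 < lam) (mu_gt0 : 0 < mu).
Variable d : nat.
Hypothesis d_gt1 : (1 < d)%N.

(* [flow] bounds the ratio of the rates in [level_step] when b = n; [kappa] makes the
   recursion x -> flow * x^d contract below it, and from the load [ground] on the
   degrees fall below kappa n / e. *)
Definition flow : R := 8 * lam * d%:R * 4 ^+ d / mu.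
Definition kappa : R := Num.min 1 (4 * flow)^-1.
Definition ground : nat := (Num.truncn ((2 * flow + 4) * 2 * expR 1 / kappa)).+1.

Lemma flow_gt0 : 0 < flow.
Proof. by rewrite divr_gt0 // !mulr_gt0 ?exprn_gt0 // ltr0n ltnW. Qed.

Lemma kappa_gt0 : 0 < kappa.
Proof. by rewrite lt_min ltr01 invr_gt0 mulr_gt0 // flow_gt0. Qed.

(** As n <= 2 (n - 2), the fraction 2b / (n - 2) of heavy routes is at most 4x; this explains the
    4^d in [flow]. *)
Lemma rise_bound n b (x : R) : (4 <= n)%N -> b%:R <= x * n%:R ->
  8 * (lam / ((n - 2) ^ d)%:R * (d * (2 * b) ^ d.-1 * (2 * (n - 2) * b))%:R)
  <= mu * (flow * x ^+ d * n%:R).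
Proof.
move=> n4 bx; have N0 : 0 < (n - 2)%:R :> R by rewrite ltr0n subn_gt0 (leq_trans _ n4).
have n0 : 0 < n%:R :> R by rewrite ltr0n (leq_trans _ n4).
have -> : 8 * (lam / ((n - 2) ^ d)%:R * (d * (2 * b) ^ d.-1 * (2 * (n - 2) * b))%:R)
   = 8 * lam * d%:R * (n - 2)%:R * ((2 * b)%:R / (n - 2)%:R) ^+ d :> R.
  have -> : (d * (2 * b) ^ d.-1 * (2 * (n - 2) * b) = d * (n - 2) * (2 * b) ^ d)%N.
    have -> : ((2 * b) ^ d = (2 * b) ^ d.-1 * (2 * b))%N.
      by rewrite -expnSr prednK // ltnW.
    by rewrite !mulnA; ring.
  rewrite expr_div_n !natrM !natrX !natrM !exprMn; field.
  by rewrite expf_neq0 ?gt_eqF.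
have -> : mu * (flow * x ^+ d * n%:R) = 8 * lam * d%:R * n%:R * (4 * x) ^+ d.
  by rewrite /flow exprMn; field; exact: lt0r_neq0.
apply: ler_pM.
- by rewrite !mulr_ge0 // ltW.
- by rewrite exprn_ge0 // divr_ge0.
- by rewrite ler_wpM2l ?mulr_ge0 ?(ltW lam_gt0) // ler_nat leq_subr.
have y0 : 0 <= (2 * b)%:R / (n - 2)%:R :> R by rewrite divr_ge0.
have yx : (2 * b)%:R / (n - 2)%:R <= 4 * x.
  rewrite ler_pdivrMr // natrM.
  have : n%:R <= 2 * (n - 2)%:R :> R by rewrite -natrM ler_nat leq_double_subn2.
  have x0 : 0 <= x by rewrite -(pmulr_lge0 _ n0); apply: le_trans bx.
  move=> nN; have := ler_wpM2l x0 nN; lra.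
by rewrite lerXn2r // nnegrE // (le_trans y0).
Qed.

End Levels.

Lemma leq_bool (a b : bool) : (a -> b) -> (a <= b)%N.
Proof. by case: a; case: b => // /(_ isT). Qed.

(** * Induction over the load levels *)

Section LevelInduction.
Variables (R : realType) (lam mu : R).
Hypotheses (lam_gt0 : 0 < lam) (mu_gt0 : 0 < mu).
Variables n B d : nat.
Hypotheses (d_gt1 : (1 < d)%N) (n_ge4 : (4 <= n)%N).
Local Notation flow := (flow lam mu d).
Local Notation kappa := (kappa lam mu d).
Local Notation ground := (ground lam mu d).
Hypothesis n_large : 4 <= kappa * Num.sqrt n%:R.
Variable pick : selection n B d.
Hypothesis pick_min : min_load_rule pick.
Variable pi : law R n B.
Hypothesis pi_st : stationary lam mu (bdar pick) pi.
Implicit Types (s t : state n B).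

Let pi_ge0 s : 0 <= pi s.
Proof. exact: stationary_ge0 pi_st. Qed.

Let n_gt2 : (2 < n)%N.
Proof. exact: leq_trans n_ge4. Qed.

(* The degrees at load ground + j stay below kappa * profile j * n.  The floor
   1 / sqrt n keeps these thresholds of order at least sqrt n, so that the error probabilities
   remain exponentially small in sqrt n. *)
Definition profile j : R := Num.max (expR (- (d ^ j)%:R)) (Num.sqrt n%:R)^-1.
(** Half of the threshold, because [level_step] bounds the excess by twice its parameter. *)
Definition level j : nat := Num.truncn (kappa * profile j * n%:R / 2).
Definition theta : R := (3 / 4) ^+ Num.truncn (kappa * Num.sqrt n%:R / 2).
(** A polynomial bound on the factor by which one level amplifies the error probability; [theta] is
    the new error each level adds before amplification. *)
Definition growth : R := 2 * (n * (n * B).+1)%:R * (1 + lam / mu) * (n * n)%:R.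

Let k0 : 0 < kappa.
Proof. exact: kappa_gt0. Qed.

Let nR_gt0 : 0 < n%:R :> R.
Proof. by rewrite ltr0n (leq_trans _ n_ge4). Qed.

Let sqrt_gt0 : 0 < Num.sqrt n%:R :> R.
Proof. by rewrite sqrtr_gt0. Qed.

Let sqrt_inv_mul : (Num.sqrt n%:R)^-1 * n%:R = Num.sqrt n%:R :> R.
Proof.
by rewrite -{2}(@sqr_sqrtr R n%:R) // expr2 mulrA mulVf ?mul1r // gt_eqF.
Qed.

Let sqrt_inv_le1 : (Num.sqrt n%:R)^-1 <= 1 :> R.
Proof.
rewrite invf_le1 //; have : Num.sqrt 1 <= Num.sqrt n%:R :> R.
  by rewrite ler_wsqrtr // ler1n (leq_trans _ n_ge4).
by rewrite sqrtr1.
Qed.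

Let k1 : kappa <= 1.
Proof. by rewrite ge_min lexx. Qed.

Let kflow : flow * kappa <= 4^-1.
Proof.
have f0 := flow_gt0 lam_gt0 mu_gt0 d_gt1.
rewrite mulrC -ler_pdivlMr // -invfM ge_min lexx orbT //.
Qed.

Let sqrt_le : Num.sqrt n%:R <= n%:R :> R.
Proof. by rewrite -[leLHS]sqrt_inv_mul ler_piMl. Qed.

Lemma profile_gt0 j : 0 < profile j.
Proof. by rewrite lt_max expR_gt0. Qed.

Lemma profile_ge_exp j : expR (- (d ^ j)%:R) <= profile j.
Proof. by rewrite /profile le_max lexx. Qed.

Lemma profile_ge_sqrt j : (Num.sqrt n%:R)^-1 <= profile j.
Proof. by rewrite /profile le_max lexx orbT. Qed.

(** The d-th power carries the exponential of level j exactly to that of level j + 1, and it only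
    lowers the floor, which is at most 1. *)
Lemma profile_pow j : profile j ^+ d <= profile j.+1.
Proof.
rewrite {1}/profile; case: (leP (expR _) (Num.sqrt _)^-1) => _.
  apply: le_trans (profile_ge_sqrt _).
  rewrite -[leRHS]expr1 ler_wiXn2l ?invr_ge0 ?sqrtr_ge0 //; exact: ltnW.
apply: le_trans (profile_ge_exp _).
by rewrite -expRM_natr mulNr -natrM -expnSr lexx.
Qed.

Lemma level_le j : (2 * level j)%:R <= kappa * profile j * n%:R.
Proof.
have x0 : 0 <= kappa * profile j * n%:R / 2.
  by rewrite divr_ge0 // !mulr_ge0 // ltW // profile_gt0.
rewrite natrM mulrC -ler_pdivlMr //.
by have /andP[] := truncn_itv x0.
Qed.

(** By [n_large] the truncated number is at least 2, so truncation loses at most half of it. *)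
Lemma level_ge j : kappa * profile j * n%:R / 4 <= (level j)%:R.
Proof.
have x4 : 4 <= kappa * profile j * n%:R.
  apply: le_trans n_large _; rewrite -{1}sqrt_inv_mul mulrA ler_wpM2r //.
  by rewrite ler_wpM2l ?(ltW k0) // profile_ge_sqrt.
have := truncnS_gt (kappa * profile j * n%:R / 2); rewrite -/(level j) -[X in _ < X]natr1.
move: x4; lra.
Qed.

Lemma theta_ge0 : 0 <= theta.
Proof. by rewrite exprn_ge0 // divr_ge0. Qed.

Lemma pow_le_theta m0 : (Num.truncn (kappa * Num.sqrt n%:R / 2) <= m0)%N ->
  (3 / 4) ^+ m0 <= theta.
Proof.
by move=> le; rewrite ler_wiXn2l ?divr_ge0 // ler_pdivrMr // mul1r ler_nat.
Qed.

Lemma pow_level_le j : (3 / 4) ^+ level j <= theta.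
Proof.
apply/pow_le_theta/le_truncn; rewrite ler_wpM2r // -{1}sqrt_inv_mul mulrA.
by rewrite ler_wpM2r // ler_wpM2l ?(ltW k0) // profile_ge_sqrt.
Qed.

Lemma crowded_step k b b0 m0 :
  b%:R <= b0 * n%:R -> flow * b0 ^+ d * n%:R <= m0%:R -> (3 / 4) ^+ m0 <= theta ->
  mean pi (fun s => (~~ [forall u, excess k s u <= 2 * m0]%N)%:R) <=
  growth * theta + growth * mean pi (fun s => (crowded k b s)%:R).
Proof.
move=> bb0 m0_ge th.
have := @level_step R lam mu lam_gt0 mu_gt0 n B d n_gt2 d_gt1 pick pick_min pi pi_st k b m0.
have le : 8 * (lam / ((n - 2) ^ d)%:R * (d * (2 * b) ^ d.-1 * (2 * (n - 2) * b))%:R) <= mu * m0%:R.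
  by apply: le_trans (rise_bound lam_gt0 mu_gt0 d_gt1 n_ge4 bb0) _; rewrite ler_wpM2l // ltW.
move=> /(_ le) /le_trans; apply; rewrite mulrDr; apply: lerD.
  rewrite /growth; set q := (n * _)%:R.
  apply: (@le_trans _ _ (2 * q * theta)); first by rewrite mulrCA -mulrA !ler_wpM2l.
  rewrite ler_wpM2r ?theta_ge0 // -[leRHS]mulrA ler_peMr ?mulr_ge0 //.
  rewrite mulr_ege1 //; first by rewrite lerDl divr_ge0 // ltW.
  by rewrite ler1n muln_gt0 (leq_trans _ n_ge4).
set delta := mean _ _; have d0 : 0 <= delta by apply: mean_ge0.
rewrite /growth; set q := (n * _)%:R.
have -> : q * (2 * (lam * (n * n)%:R / mu * delta)) = 2 * q * (lam / mu) * (n * n)%:R * delta by ring.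
rewrite ler_wpM2r // ler_wpM2r // ler_wpM2l ?mulr_ge0 // lerDr //.
Qed.

Lemma growth_ge1 : 1 <= growth.
Proof.
have : 0 <= lam / mu by rewrite divr_ge0 // ltW.
have : 1 <= (n * n)%:R :> R by rewrite ler1n muln_gt0 (leq_trans _ n_ge4).
have : 1 <= (n * (n * B).+1)%:R :> R by rewrite ler1n muln_gt0 (leq_trans _ n_ge4).
rewrite /growth; set x := _%:R; set y := _%:R; set t := lam / mu => x1 y1 t0.
by rewrite -!mulrA !mulr_ege1 // ?ler1n // lerDl.
Qed.

(** The recursion starts from the trivial bound [n] on the degrees at load 0. It gives a total load
    of order n at each vertex, so few edges there have load at least [ground]. *)
Lemma crowded_ground : mean pi (fun s => (crowded ground (2 * level 0) s)%:R) <= growth * theta.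
Proof.
(* The first summand meets the rate condition, the summand [n] makes (3/4)^m0 at most [theta]. *)
pose m0 := ((Num.truncn (flow * n%:R)).+1 + n)%N.
have f0 := flow_gt0 lam_gt0 mu_gt0 d_gt1.
have fn0 : 0 <= flow * n%:R by rewrite mulr_ge0 // ltW.
have := @crowded_step 0 n 1 m0; rewrite mul1r lexx expr1n mulr1 => /(_ isT).
have m0_ge : flow * n%:R <= m0%:R.
  by rewrite natrD; have := truncnS_gt (flow * n%:R); have := ltW nR_gt0; lra.
have m0_le : m0%:R <= flow * n%:R + 1 + n%:R.
  by rewrite natrD lerD2r -natr1 lerD2r; have /andP[] := truncn_itv fn0.
have m0_theta : (3 / 4) ^+ m0 <= theta.
  apply: pow_le_theta; apply: leq_trans (leq_addl _ _).
  rewrite truncn_le_nat; apply: (@le_lt_trans _ _ n%:R); last by rewrite ltr_nat.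
  rewrite ler_pdivrMr //; apply: (@le_trans _ _ (1 * n%:R)).
    by rewrite ler_pM ?(ltW k0) ?(ltW sqrt_gt0).
  by rewrite mul1r ler_peMr ?(ltW nR_gt0) // ler1n.
move=> /(_ m0_ge m0_theta).
have -> : mean pi (fun s => (crowded 0 n s)%:R) = 0 :> R.
  apply: big1 => s _; rewrite (_ : crowded 0 n s = false) ?mulr0 //.
  by apply/negbTE; rewrite negbK; apply/forallP => v; apply: degree_le.
rewrite mulr0 addr0; apply: le_trans; apply: (mean_le pi_ge0) => s _.
rewrite ler_nat; apply: leq_bool.
apply: contraNN => /forallP H; apply/forallP => u.
have ground_gt0 : (0 < ground)%N by [].
rewrite -(leq_pmul2l ground_gt0); apply: leq_trans (mul_degree_le _ _ _) _.
apply: leq_trans (H u) _; rewrite -(ler_nat R) 2!natrM.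
have lev : kappa / expR 1 * n%:R / 4 <= (level 0)%:R.
  apply: le_trans (level_ge 0); rewrite ler_wpM2r // ler_wpM2r // ler_wpM2l ?(ltW k0) //.
  by have := profile_ge_exp 0; rewrite expn0 expRN.
have gr : (2 * flow + 4) * 2 * expR 1 / kappa <= ground%:R := ltW (truncnS_gt _).
have e0 : 0 < expR 1 :> R := expR_gt0 _.
(* The constant in [ground] is chosen so that this product is (flow + 2) n, an upper bound for
   [m0]. *)
have : (2 * flow + 4) * 2 * expR 1 / kappa * (kappa / expR 1 * n%:R / 4) <= ground%:R * (level 0)%:R.
  apply: ler_pM => //; first by rewrite divr_ge0 ?(ltW k0) // !mulr_ge0 ?(ltW e0) // addr_ge0 // mulr_ge0 // ltW.
  by rewrite !divr_ge0 // mulr_ge0 // divr_ge0 // ltW.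
have -> : (2 * flow + 4) * 2 * expR 1 / kappa * (kappa / expR 1 * n%:R / 4) = (flow + 2) * n%:R.
  by field; rewrite !gt_eqF.
rewrite natrM; have : 1 <= n%:R :> R by rewrite ler1n (leq_trans _ n_ge4).
move: m0_le; set y := ground%:R * _ => m0_le n1 H1.
have -> : ground%:R * (2 * (level 0)%:R) = 2 * y by rewrite /y; ring.
lra.
Qed.

(** A degree is bounded by the excess one load below. The threshold x = kappa profile(j) gives flow
    x^d <= flow kappa^2 profile(j + 1) <= kappa profile(j + 1) / 4, which fits under the next
    level. *)
Lemma crowded_level j :
  mean pi (fun s => (crowded (ground + j) (2 * level j) s)%:R) <= (2 * growth) ^+ j.+1 * theta.
Proof.
have g1 := growth_ge1; have th0 := theta_ge0.
elim: j => [|j IH].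
  rewrite addn0 expr1; apply: le_trans crowded_ground _.
  by rewrite ler_wpM2r // ler_peMl ?ler1n // (le_trans ler01).
rewrite addnS.
apply: (@le_trans _ _ (mean pi (fun s =>
   (~~ [forall u, excess (ground + j) s u <= 2 * level j.+1]%N)%:R))).
  apply: (mean_le pi_ge0) => s _; rewrite ler_nat; apply: leq_bool.
  apply: contraNN => /forallP H; apply/forallP => u.
  exact: leq_trans (degree_le_excess _ _ _) (H u).
have := @crowded_step (ground + j) (2 * level j) (kappa * profile j) (level j.+1) (level_le j).
move=> /(_ _ (pow_level_le _)) => H; apply: le_trans (H _) _.
  apply: le_trans (level_ge _).
  have -> : flow * (kappa * profile j) ^+ d * n%:R = flow * kappa ^+ d * profile j ^+ d * n%:R.
    by rewrite exprMn; ring.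
  have -> : kappa * profile j.+1 * n%:R / 4 = 4^-1 * kappa * profile j.+1 * n%:R by ring.
  have f0 := flow_gt0 lam_gt0 mu_gt0 d_gt1; have pj := profile_gt0 j.
  have kd0 : 0 <= kappa ^+ d by rewrite exprn_ge0 // ltW.
  rewrite ler_wpM2r //; apply: ler_pM (profile_pow j); rewrite ?exprn_ge0 ?(ltW pj) //.
    by rewrite mulr_ge0 // ltW.
  have : kappa ^+ d <= kappa ^+ 2 by rewrite ler_wiXn2l ?(ltW k0).
  rewrite expr2 => /(ler_wpM2l (ltW f0)) /le_trans; apply.
  by rewrite mulrA ler_wpM2r ?(ltW k0).
apply: (@le_trans _ _ (growth * theta + growth * ((2 * growth) ^+ j.+1 * theta))).
  by rewrite lerD2l ler_wpM2l // (le_trans ler01).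
rewrite [(2 * growth) ^+ j.+2]exprS.
have : 1 <= (2 * growth) ^+ j.+1 by rewrite exprn_ege1 //; lra.
set x := _ ^+ _ => x1.
have -> : 2 * growth * x * theta = growth * theta * x + growth * (x * theta) by ring.
by rewrite lerD2r ler_peMr // mulr_ge0 // (le_trans ler01).
Qed.

End LevelInduction.

(** * Choice of the number of levels *)

Section BdarFinal.
Variables (R : realType) (lam mu : R).
Hypotheses (lam_gt0 : 0 < lam) (mu_gt0 : 0 < mu).
Variable d : nat.
Hypothesis d_gt1 : (1 < d)%N.
Local Notation kappa := (kappa lam mu d).
Local Notation ground := (ground lam mu d).

(** Once d^J >= ln n the profile has reached its floor, so outside the crowding error at most sqrt n
    edges per vertex have load [B]. A draw is then heavy with probability at most 4 / sqrt n, and at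
    least two draws give 16 / n. *)
Lemma bdar_loss_levels n J B (pick : selection n B d) (pi : law R n B) :
  B = (ground + J)%N -> min_load_rule pick -> stationary lam mu (bdar pick) pi ->
  (16 <= n)%N -> 4 <= kappa * Num.sqrt n%:R -> ln n%:R <= (d ^ J)%:R :> R ->
  loss_prob (bdar pick) pi <= 16 / n%:R + (2 * growth lam mu n B) ^+ J.+1 * theta lam mu n d.
Proof.
move=> BE pick_min pi_st n16 n_large dJ.
have n4 : (4 <= n)%N by exact: leq_trans n16.
have n2 : (2 < n)%N by exact: leq_trans n4.
have n0 : 0 < n%:R :> R by rewrite ltr0n (leq_trans _ n4).
set S := Num.sqrt n%:R in n_large *.
have S0 : 0 < S by rewrite sqrtr_gt0.
have SE : S ^+ 2 = n%:R by rewrite sqr_sqrtr // ltW.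
have S4 : 4 <= S.
  by rewrite -(@ler_pXn2r _ 2) ?nnegrE ?(ltW S0) // SE -natrX ler_nat.
apply: le_trans (bdar_loss_le pick_min n2 pi_st (2 * level lam mu n d J)) _.
apply: lerD; last first.
  have := crowded_level lam_gt0 mu_gt0 d_gt1 n4 n_large pick_min pi_st J.
  by rewrite -BE.
have pJ : profile R n d J = S^-1.
  rewrite /profile max_r // -/S; apply: (@le_trans _ _ n%:R^-1).
    rewrite -ler_ln ?posrE ?invr_gt0 ?expR_gt0 // expRK lnV ?posrE // lerN2 //.
  by rewrite -SE lef_pV2 ?posrE ?exprn_gt0 // expr2 ler_peMr ?(ltW S0) //; lra.
have b_le : (2 * level lam mu n d J)%:R <= S.
  have := level_le lam_gt0 mu_gt0 n d_gt1 J; rewrite pJ => /le_trans; apply.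
  rewrite -SE expr2 -mulrA mulKf ?gt_eqF // ler_piMl ?(ltW S0) //.
  by rewrite ge_min lexx.
have N0 : 0 < (n - 2)%:R :> R by rewrite ltr0n subn_gt0.
have x_le : (2 * (2 * level lam mu n d J))%:R / (n - 2)%:R <= 4 / S.
  rewrite ler_pdivrMr // mulrAC ler_pdivlMr // natrM.
  have : n%:R <= 2 * (n - 2)%:R :> R by rewrite -natrM ler_nat leq_double_subn2.
  rewrite -SE => nN; have := ler_wpM2r (ltW S0) b_le; rewrite -expr2; lra.
have x0 : 0 <= (2 * (2 * level lam mu n d J))%:R / (n - 2)%:R :> R by rewrite divr_ge0.
apply: (@le_trans _ _ ((4 / S) ^+ d)).
  by rewrite lerXn2r // nnegrE // (le_trans x0).
have -> : 16 / n%:R = (4 / S) ^+ 2 by rewrite -SE; field; exact: lt0r_neq0.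
apply: ler_wiXn2l => //; first by rewrite (le_trans x0).
by rewrite ler_pdivrMr // mul1r.
Qed.

(** The successor of the integer part, so that d^(steps n) reaches ln n once n is large. *)
Definition steps n : nat := (Num.truncn (ln (ln (n%:R : R)) / ln d%:R)).+1.

Let lnd0 : 2^-1 <= ln d%:R :> R.
Proof.
apply: (@le_trans _ _ (ln 2)); last first.
  by rewrite ler_ln ?posrE ?ltr0n ?ler_nat // ltnW.
rewrite -[2 in leRHS]invrK lnV ?posrE ?invr_gt0 // -[leLHS]opprK lerN2.
have -> : 2^-1 = 1 + - 2^-1 :> R by field.
by rewrite (le_trans (le_ln1Dx _)) //; lra.
Qed.

(** The growth factor is polynomial in n and there are O(ln n) levels, so the amplification is
    exp(O(ln^2 n)), while [theta] is exponentially small in sqrt n. With S = n^(1/4), ln^2 n is O(S)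
    and sqrt n is S^2. *)
Lemma growth_theta_le : exists K : R, forall n, K <= Num.sqrt (Num.sqrt n%:R) ->
  [/\ (17 * 17 <= n)%N, 4 <= kappa * Num.sqrt n%:R, ln n%:R <= (d ^ steps n)%:R :> R &
    (2 * growth lam mu n (ground + steps n)) ^+ (steps n).+1 * theta lam mu n d <= 1 / n%:R].
Proof.
have k0 := kappa_gt0 lam_gt0 mu_gt0 d_gt1.
pose t := lam / mu; have t0 : 0 < t by rewrite divr_gt0.
pose l : R := ln (4 / 3); have l0 : 0 < l by apply: ln_gt0; lra.
have kinv : 0 < kappa^-1 by rewrite invr_gt0.
(* The exponent of the amplification is at most 6 L * 3 L = 18 L^2, and L^2 <= 64 S. *)
have [A A0 AE] : exists2 A : R, 0 < A & forall x, 18 * (64 * x) = A * x.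
  by exists (18 * 64) => [|x]; [rewrite mulr_gt0 | rewrite mulrA].
have lk0 : 0 < (A + 8 + l) * 2 / (l * kappa).
  by rewrite divr_gt0 ?mulr_gt0 // !addr_gt0.
exists (17 + ground%:R + 24 + 4 * kappa^-1 + 8 * (1 + t) + (A + 8 + l) * 2 / (l * kappa) + expR 1).
move=> n; set S := Num.sqrt (Num.sqrt n%:R) => KS.
have e0 : 0 < expR 1 :> R by exact: expR_gt0.
have g0 : 0 <= ground%:R :> R by [].
have S17 : 17 <= S by lra.
have S0 : 0 < S by lra.
have S2 : S ^+ 2 = Num.sqrt n%:R by rewrite sqr_sqrtr ?sqrtr_ge0.
have S4 : S ^+ 4 = n%:R by rewrite (exprM S 2 2) S2 sqr_sqrtr.
have n0 : 0 < n%:R :> R by rewrite -S4 exprn_gt0.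
have nS : S <= n%:R by rewrite -S4 exprS ler_peMr ?(ltW S0) // exprn_ege1 //; lra.
have n17 : (17 * 17 <= n)%N.
  rewrite -(ler_nat R) -S4 natrM (exprM S 2 2) expr2 ler_pM //.
    by rewrite expr2 -[leLHS]mulr1 ler_pM //; lra.
  by rewrite expr2 -[leLHS]mulr1 ler_pM //; lra.
have klarge : 4 <= kappa * Num.sqrt n%:R.
  rewrite -S2 -ler_pdivrMl // expr2 mulrC; apply: (@le_trans _ _ (S * 1)).
    rewrite mulr1; lra.
  by rewrite ler_wpM2l ?(ltW S0) //; lra.
set L := ln n%:R; have LE : L = 4 * ln S by rewrite /L -S4 lnXn // mulr_natl.
have lnS1 : 1 <= ln S.
  by rewrite -[leLHS]expRK ler_ln ?posrE //; lra.
have lnL0 : 0 <= ln L by apply: ln_ge0; lra.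
have L0 : 0 < L by lra.
have LL : ln L <= L by apply: ltW; exact: ln_sublinear.
pose q := Num.sqrt S; have q0 : 0 < q by rewrite sqrtr_gt0.
have qE : q ^+ 2 = S by rewrite sqr_sqrtr // ltW.
have Lq : L <= 8 * q by rewrite LE; have := ln_le_2sqrt S0; rewrite -/q; lra.
have LS2 : L ^+ 2 <= 64 * S.
  have -> : 64 * S = (8 * q) ^+ 2 by rewrite exprMn qE; ring.
  by rewrite lerXn2r ?nnegrE ?(ltW L0) // mulr_ge0 // ltW.
have q1 : 1 <= q.
  by rewrite -(@ler_pXn2r _ 2) ?nnegrE ?(ltW q0) // qE expr1n; lra.
have LS : L <= 8 * S.
  by apply: le_trans Lq _; rewrite ler_wpM2l // -qE expr2 ler_peMr // ltW.
set J := steps n.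
have ld0 : 0 < ln d%:R :> R by apply: lt_le_trans lnd0.
have JL : J%:R <= 2 * L + 1.
  rewrite /J /steps -[leLHS]natr1 lerD2r -/L; have : 0 <= ln L / ln d%:R by rewrite divr_ge0 // ltW.
  move=> /truncn_itv /andP[/le_trans + _]; apply; rewrite ler_pdivrMr //.
  apply: (@le_trans _ _ (2 * L * 2^-1)); last by rewrite ler_wpM2l // mulr_ge0 // ltW.
  by rewrite mulrAC mulfV ?mul1r.
have dJ : L <= (d ^ J)%:R.
  rewrite -ler_ln ?posrE ?ltr0n ?expn_gt0 ?(ltnW d_gt1) // natrX lnXn ?ltr0n ?(ltnW d_gt1) //.
  by rewrite -[leRHS]mulr_natl -ler_pdivrMr //; apply: ltW; exact: truncnS_gt.
split=> //; clearbody J.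
have J3 : J.+1%:R <= 3 * L by rewrite -[J.+1%:R]natr1; lra.
have Bn : (ground + J <= n)%N.
  rewrite -(ler_nat R) natrD; apply: (@le_trans _ _ (S * (ground%:R + 24))).
    rewrite mulrDr; have : ground%:R <= S * ground%:R by rewrite ler_peMl //; lra.
    lra.
  apply: (@le_trans _ _ (S * S)); first by rewrite ler_wpM2l ?(ltW S0) //; lra.
  by rewrite -S4 (exprD S 2 2) -expr2 ler_peMr ?sqr_ge0 // exprn_ege1 //; lra.
have gr : 2 * growth lam mu n (ground + J) <= n%:R ^+ 6.
  rewrite /growth -/t; set b := (_ * _.+1)%N.
  have b_le : b%:R <= 2 * n%:R ^+ 3 :> R.
    rewrite natrM -natr1 natrM mulrDr mulr1.
    have : (ground + J)%:R <= n%:R :> R by rewrite ler_nat.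
    have n1 : 1 <= n%:R :> R by lra.
    move=> Bn'; apply: (@le_trans _ _ (n%:R * (n%:R * n%:R) + n%:R * (n%:R * n%:R))); last first.
      by rewrite le_eqVlt; apply/orP; left; apply/eqP; ring.
    apply: lerD; first by rewrite !ler_wpM2l.
    by rewrite ler_peMr // mulr_ege1.
  apply: (@le_trans _ _ (2 * (2 * (2 * n%:R ^+ 3) * (1 + t) * (n * n)%:R))).
    have t1 : 0 <= 1 + t by lra.
    by rewrite ler_wpM2l // ler_wpM2r // ler_wpM2r // ler_wpM2l.
  have -> : 2 * (2 * (2 * n%:R ^+ 3) * (1 + t) * (n * n)%:R) = 8 * (1 + t) * n%:R ^+ 5 :> R.
    by rewrite natrM; ring.
  by rewrite [leRHS]exprS ler_wpM2r ?exprn_ge0 //; lra.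
have gr0 : 0 <= 2 * growth lam mu n (ground + J).
  rewrite mulr_ge0 // /growth -/t !mulr_ge0 //; lra.
have nE : n%:R = expR L by rewrite /L lnK ?posrE.
(* The surplus exp(- 8 S) is at most 1 / n because L <= 8 S. *)
apply: (@le_trans _ _ (expR (A * S) * expR (- ((A + 8) * S)))); last first.
  rewrite -expRD div1r nE -expRN ler_expR; lra.
apply: ler_pM => //; rewrite ?exprn_ge0 ?theta_ge0 //.
  apply: (@le_trans _ _ ((n%:R ^+ 6) ^+ J.+1)).
    by rewrite lerXn2r ?nnegrE ?exprn_ge0.
  rewrite -exprM nE -expRM_natr ler_expR natrM.
  apply: (@le_trans _ _ (L * (6 * (3 * L)))).
    by rewrite ler_wpM2l ?(ltW L0) // ler_wpM2l.
  have -> : L * (6 * (3 * L)) = 18 * L ^+ 2 by ring.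
  by rewrite -AE ler_wpM2l.
rewrite /theta; set M := Num.truncn _.
have -> : (3 / 4 : R) = expR (- l) by rewrite expRN lnK ?posrE ?invf_div.
rewrite -expRM_natr ler_expR mulNr lerN2.
have M_ge : kappa * S ^+ 2 / 2 - 1 <= M%:R.
  by have := truncnS_gt (kappa * Num.sqrt n%:R / 2); rewrite -/M -[X in _ < X]natr1 -S2; lra.
apply: le_trans (ler_wpM2l (ltW l0) M_ge).
have : (A + 8 + l) * 2 / (l * kappa) <= S by lra.
rewrite ler_pdivrMr ?mulr_gt0 // => H.
have H2 := ler_wpM2r (ltW S0) H.
have -> : l * (kappa * S ^+ 2 / 2 - 1) = S * (l * kappa) * S / 2 - l by field.
have lS : l <= l * S by rewrite ler_peMr ?(ltW l0) //; lra.
lra.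
Qed.

End BdarFinal.

(** * The capacity sequence for BDAR* *)

Section CapacitySequence.
Variable R : realType.
Variable d : nat.
Hypothesis d_gt1 : (1 < d)%N.
Local Open Scope classical_set_scope.
Local Open Scope ring_scope.

Lemma near_root4_ge (K : R) : \forall n \near \oo, K <= Num.sqrt (Num.sqrt n%:R).
Proof.
near=> n; apply: (@le_trans _ _ `|K|); first exact: ler_norm.
rewrite -(@ler_pXn2r _ 2) ?nnegrE ?sqrtr_ge0 // sqr_sqrtr ?sqrtr_ge0 //.
rewrite -(@ler_pXn2r _ 2) ?nnegrE ?sqrtr_ge0 ?exprn_ge0 // sqr_sqrtr //.
by near: n; apply: nbhs_infty_ger.
Unshelve. all: by end_near. Qed.

Let lnd0 : 0 < ln d%:R :> R.
Proof. by rewrite ln_gt0 // ltr1n. Qed.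

Lemma steps_homo : {homo steps R d : m n / (m <= n)%N}.
Proof.
(* For m <= 1 the outer logarithm takes its default value 0 on nonpositive arguments, so [steps] has
   its least value 1. *)
move=> m n mn; rewrite ltnS; have [lm|lm] := leP (ln (m%:R : R)) 0.
  by rewrite ln0 // mul0r truncn0.
have m0 : (0 < m)%N by rewrite lt0n; apply: contraTneq lm => ->; rewrite ln0 ?ltxx.
have lmn : ln (m%:R : R) <= ln n%:R.
  by rewrite ler_ln ?posrE ?ltr0n ?ler_nat // (leq_trans m0 mn).
by apply: le_truncn; rewrite ler_pM2r ?invr_gt0 // ler_ln ?posrE // (lt_le_trans lm).
Qed.

(** The difference lies between 0 and g + 1, while ln ln n / ln d tends to infinity. *)
Lemma steps_equiv g :
  (fun n => (g + steps R d n)%:R : R^o) = (fun n => ln (ln n%:R) / ln d%:R : R^o)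
    +o_\oo (fun n => ln (ln n%:R) / ln d%:R : R^o).
Proof.
apply/eqaddoP => eps eps0; near=> n.
set x : R := ln (ln n%:R) / ln d%:R.
have xK : (g.+1%:R / eps) <= x.
  rewrite ler_pdivlMr // -[leLHS]expRK ler_ln ?posrE ?expR_gt0 //.
    by near: n; apply: near_ln_ge.
  by apply: lt_le_trans (expR_gt0 1) _; near: n; apply: near_ln_ge.
have x0 : 0 <= x by apply: le_trans xK; rewrite divr_ge0 // ltW.
have /andP[tx xt] := truncn_itv x0.
have gx : g.+1%:R <= eps * x by rewrite mulrC -ler_pdivrMr.
rewrite [`|x|]ger0_norm //; apply: le_trans gx.
rewrite -[(_ - _) n]/((g + steps R d n)%:R - x) /steps -/x natrD.
rewrite -[(Num.truncn x).+1%:R]natr1 -[g.+1%:R]natr1 in xt *.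
have g0 : 0 <= g%:R :> R by [].
by rewrite ger0_norm; lra.
Unshelve. all: by end_near. Qed.

End CapacitySequence.

Lemma bdar_sufficient (R : realType) (lam mu : R) (d : nat) :
  0 < lam -> 0 < mu -> (1 < d)%N ->
  forall pick : forall n, selection n (ground lam mu d + steps R d n) d,
    (forall n, min_load_rule (pick n)) ->
    not_lost_whp lam mu (fun n => bdar (pick n)).
Proof.
move=> lam0 mu0 d1 pick pick_min.
have ex n := bdar_stationary_exists lam0 mu0 (pick n).
exists (fun n => projT1 (cid (ex n))); split=> [n|]; first exact: (projT2 (cid (ex n))).
have [K HK] := growth_theta_le lam0 mu0 d1.
(* The loss is at most 17 / n, and 17 <= sqrt n leaves the exponent 1/2. *)
exists 2^-1 => //; near=> n.
have /HK[n17 klarge dJ gth] : K <= Num.sqrt (Num.sqrt n%:R).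
  by near: n; apply: near_root4_ge.
have [pi_st _] := projT2 (cid (ex n)).
rewrite lerD2l lerN2 powR12_sqrt //.
have n16 : (16 <= n)%N by apply: leq_trans n17.
have := bdar_loss_levels lam0 mu0 d1 (erefl _) (pick_min n) pi_st n16 klarge dJ.
move=> /le_trans; apply; apply: le_trans (lerD (lexx _) gth) _.
have n0 : 0 < n%:R :> R by rewrite ltr0n (leq_trans _ n16).
set S := Num.sqrt _; have S0 : 0 < S by rewrite sqrtr_gt0.
have SE : S ^+ 2 = n%:R by rewrite sqr_sqrtr // ltW.
have S17 : 17 <= S.
  by rewrite -(@ler_pXn2r _ 2) ?nnegrE ?(ltW S0) // SE expr2 -natrM ler_nat.
rewrite -mulrDl -SE expr2 invfM mulrA ler_wpM2r ?invr_ge0 ?(ltW S0) //.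
by rewrite ler_pdivrMr // mul1r natr1.
Unshelve. all: by end_near. Qed.

Local Open Scope classical_set_scope.
Local Open Scope ring_scope.

Theorem theorem1 (R : realType) (lam mu : R) (d : nat)
    (hlam : 0 < lam) (hmu : 0 < mu) (hd : (2 <= d)%N) :
  (forall B : nat -> nat,
     {homo B : m n / (m <= n)%N} ->
     not_lost_whp lam mu (fun n => @dar n (B n) d) ->
     exists2 C : R, 0 < C &
       \forall n \near \oo,
         C * Num.sqrt (ln n%:R / (d%:R * ln (ln n%:R))) <= (B n)%:R)
  /\
  (exists B : nat -> nat,
     [/\ {homo B : m n / (m <= n)%N},
         (fun n => (B n)%:R : R^o)
           = (fun n => ln (ln n%:R) / ln d%:R : R^o)
             +o_\oo (fun n => ln (ln n%:R) / ln d%:R : R^o) &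
         forall pick : forall n, selection n (B n) d,
           (forall n, min_load_rule (pick n)) ->
           not_lost_whp lam mu (fun n => bdar (pick n))]).
Proof.
split=> [B _|]; first exact: dar_necessary (ltnW hd).
exists (fun n => ground lam mu d + steps R d n)%N; split.
- by move=> m n mn; rewrite leq_add2l steps_homo.
- exact: steps_equiv.
- exact: bdar_sufficient.
Qed.
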